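(* Let $(\mathcal{M},g,V,\lambda,\rho)$ be a Ricci-Bourguignon soliton with potential vector field $V$ and let $\psi:(\mathcal{M},\nabla,g)\to(\mathcal{N},\hat\nabla,\hat g)$ be a statistical submersion. If the horizontal distribution $\mathcal{H}$ is parallel, then the following hold: (1) if $V$ is vertical, then $(\mathcal{N},\hat\nabla,\hat g)$ is an Einstein manifold; (2) if $V$ is horizontal, then $(\mathcal{N},\hat\nabla,\hat g)$ is a Ricci-Bourguignon soliton with potential vector field $V'=\psi_{\ast}V$.
   Context: A statistical manifold $(\mathcal{M},\nabla,g)$ is a Riemannian manifold $(\mathcal{M},g)$ with a torsion-free affine connection $\nabla$ such that $(\nabla_Ug)(V,W)=(\nabla_Vg)(U,W)$. A statistical submersion $\psi:(\mathcal{M},\nabla,g)\to(\mathcal{N},\hat\nabla,\hat g)$ between statistical manifolds is a Riemannian submersion with $\psi_{\ast}(\nabla_XY)_r=(\hat\nabla_{\psi_{\ast}X}\psi_{\ast}Y)_{\psi(r)}$ for all basic (i.e. horizontal and projectable) vector fields $X,Y$ and all $r\in\mathcal{M}$. A distribution $\mathcal{D}$ is parallel (with respect to $\nabla$) if $\nabla_UD\in\Gamma(\mathcal{D})$ for every vector field $U$ and every $D\in\Gamma(\mathcal{D})$. A Riemannian manifold of dimension at least $3$ is a Ricci-Bourguignon soliton $(\mathcal{M},g,V,\lambda,\rho)$ with potential vector field $V$ if $\frac12\mathcal{L}_Vg+Ric+(\lambda-\rho R)g=0$, where $\rho$ is a nonzero real constant and $\lambda$ a real constant. For a statistical manifold,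 $Ric$ and $R$ are the Ricci tensor and scalar curvature of the given connection ($\nabla$ on $\mathcal{M}$, $\hat\nabla$ on $\mathcal{N}$), and the paper writes $(\mathcal{L}_Vg)(X,Y)=g(\nabla_XV,Y)+g(\nabla_YV,X)$. $(\mathcal{N},\hat\nabla,\hat g)$ is Einstein if the Ricci tensor $\hat{Ric}$ of $\hat\nabla$ is a scalar multiple of $\hat g$.
   Formalization: In (2), when ρ·(dim M − dim N) = 1, the scalar curvature R of M is assumed constant; without this (2) is false. The soliton constants on N are some λ', ρ' (ρ' nonzero), not necessarily λ, ρ, and Einstein means that the Ricci tensor of N is a function times the metric. *)

(* Defs.v *)
From HB Require Import structures.
From mathcomp Require Import all_boot all_order all_algebra.
From mathcomp Require Import all_classical all_reals all_analysis.
Import Order.TTheory GRing.Theory Num.Theory.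
Import numFieldNormedType.Exports.

Set Implicit Arguments.
Unset Strict Implicit.
Unset Printing Implicit Defensive.

Local Open Scope classical_set_scope.
Local Open Scope ring_scope.

(** * Smooth manifolds *)

(** [C^oo] on an open set [U], as infinite differentiability: [f] is
    differentiable on [U] and so are all its iterated directional
    derivatives. *)
Fixpoint ndifferentiable_on (R : realType) (E W : normedModType R) (k : nat)
    (U : set E) (f : E -> W) : Prop :=
  if k is k'.+1 then
    (forall x, U x -> differentiable f x) /\
    (forall v : E, ndifferentiable_on k' U ('D_v f))
  else True.

Definition smooth_on (R : realType) (E W : normedModType R)
    (U : set E) (f : E -> W) : Prop :=
  forall k, ndifferentiable_on k U f.

Record chart (R : realType) (n : nat) (M : topologicalType) := Chart {
  dom : set M ;
  coord : M -> 'rV[R]_n ;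
  icoord : 'rV[R]_n -> M ; (* only meaningful on the image of [dom] *)
  dom_open : open dom ;
  image_open : open (coord @` dom) ;
  coordK : forall p, dom p -> icoord (coord p) = p ;
  coord_continuous : forall p, dom p -> {for p, continuous coord} ;
  icoord_continuous :
    forall p, dom p -> {for coord p, continuous icoord} }.

(** [chart_at] singles out one chart of the atlas around each point. It only
    serves to identify the tangent space at [p] with ['rV_n]; another choice
    changes the coordinates of tangent vectors, not the geometry. *)
Record manifold (R : realType) (n : nat) := Manifold {
  space :> topologicalType ;
  space_hausdorff : hausdorff_space space ;
  space_second_countable : @second_countable space ;
  atlas : set (chart R n space) ;
  chart_at : space -> chart R n space ;
  chart_at_atlas : forall p, atlas (chart_at p) ;
  chart_at_dom : forall p, dom (chart_at p) p ;
  atlas_compat : forall c d, atlas c -> atlas d ->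
    smooth_on (coord c @` (dom c `&` dom d)) (coord d \o icoord c) }.

Arguments atlas {R n} m.
Arguments chart_at {R n} {m} p.

Section Tangent.
Variables (R : realType) (n : nat) (M : manifold R n).

(** A tangent vector at [p] is given by its components in [chart_at p]. *)
Definition vfield := M -> 'rV[R]_n.

(** Derivative at [p] of [F : M -> W] in the direction [v] of [T_p M]. *)
Definition tderive (W : normedModType R) (F : M -> W) (p : M)
    (v : 'rV[R]_n) : W :=
  'D_v (F \o icoord (chart_at p)) (coord (chart_at p) p).

(** Component vector of [X] in the chart [c]. *)
Definition components (c : chart R n M) (X : vfield) : M -> 'rV[R]_n :=
  fun p => tderive (coord c) p (X p).

Definition smooth_fun (f : M -> R) : Prop :=
  forall c, atlas M c -> smooth_on (coord c @` dom c) (f \o icoord c : _ -> R^o).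

Definition smooth_vfield (X : vfield) : Prop :=
  forall c, atlas M c ->
    smooth_on (coord c @` dom c) (components c X \o icoord c).

Definition fderive (X : vfield) (f : M -> R) : M -> R :=
  fun p => tderive (f : M -> R^o) p (X p).

(** [[X, Y]^k = X^i d_i Y^k - Y^i d_i X^k], computed at [p] in
    [chart_at p]. *)
Definition bracket (X Y : vfield) : vfield := fun p =>
  tderive (components (chart_at p) Y) p (X p) -
  tderive (components (chart_at p) X) p (Y p).

(** * Riemannian metrics and affine connections *)

(** [gram p] is the Gram matrix of the metric on [T_p M] in [chart_at p]. *)
Definition form_at (gram : M -> 'M[R]_n) (p : M) (u v : 'rV[R]_n) : R :=
  (u *m gram p *m v^T) 0 0.

Record metric := Metric {
  gram : M -> 'M[R]_n ;
  gram_sym : forall p, (gram p)^T = gram p ;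
  gram_pos : forall p u, u != 0 -> 0 < form_at gram p u u ;
  gram_smooth : forall X Y, smooth_vfield X -> smooth_vfield Y ->
    smooth_fun (fun p => form_at gram p (X p) (Y p)) }.

Definition inner (g : metric) := form_at (gram g).

Definition innerf (g : metric) (X Y : vfield) : M -> R :=
  fun p => inner g p (X p) (Y p).

(** The values of a connection outside smooth fields are irrelevant. *)
Record connection := Connection {
  covd :> vfield -> vfield -> vfield ;
  covd_smooth : forall X Y, smooth_vfield X -> smooth_vfield Y ->
    smooth_vfield (covd X Y) ;
  covdDl : forall X X' Y,
    smooth_vfield X -> smooth_vfield X' -> smooth_vfield Y ->
    covd (X + X') Y = covd X Y + covd X' Y ;
  covdMl : forall f X Y,
    smooth_fun f -> smooth_vfield X -> smooth_vfield Y ->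
    covd (fun p => f p *: X p) Y = fun p => f p *: covd X Y p ;
  covdDr : forall X Y Y',
    smooth_vfield X -> smooth_vfield Y -> smooth_vfield Y' ->
    covd X (Y + Y') = covd X Y + covd X Y' ;
  covdMr : forall f X Y,
    smooth_fun f -> smooth_vfield X -> smooth_vfield Y ->
    covd X (fun p => f p *: Y p) =
    fun p => fderive X f p *: Y p + f p *: covd X Y p }.

Definition torsion_free (nabla : connection) : Prop :=
  forall X Y, smooth_vfield X -> smooth_vfield Y ->
    nabla X Y - nabla Y X = bracket X Y.

(** [(nabla_U g)(V, W)] *)
Definition covd_metric (nabla : connection) (g : metric) (U V W : vfield) :
    M -> R := fun p =>
  fderive U (innerf g V W) p - innerf g (nabla U V) W p -
  innerf g V (nabla U W) p.

Definition statistical (nabla : connection) (g : metric) : Prop :=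
  torsion_free nabla /\
  forall U V W, smooth_vfield U -> smooth_vfield V -> smooth_vfield W ->
    covd_metric nabla g U V W = covd_metric nabla g V U W.

(** A distribution assigns to [p] a set of tangent vectors at [p]. *)
Definition parallel (nabla : connection) (D : M -> set 'rV[R]_n) : Prop :=
  forall U Y, smooth_vfield U -> smooth_vfield Y ->
    (forall p, D p (Y p)) -> forall p, D p (nabla U Y p).

(** * Curvature *)

Definition curvature (nabla : connection) (X Y Z : vfield) : vfield :=
  nabla X (nabla Y Z) - nabla Y (nabla X Z) - nabla (bracket X Y) Z.

(** A smooth vector field on [M] with value [v] at [p]. *)
Definition extend (p : M) (v : 'rV[R]_n) : vfield :=
  xget (0 : vfield) [set X | smooth_vfield X /\ X p = v].

(** [Ric(X, Y)(p)] is the trace of the endomorphism [z |-> R(z, X) Y] of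
    [T_p M]; by tensoriality the choice of the extension is irrelevant, here
    and in [scalar_curvature]. *)
Definition ricci (nabla : connection) (X Y : vfield) : M -> R := fun p =>
  \tr (lin1_mx (fun z => curvature nabla (extend p z) X Y p)).

(** [g^{ij} Ric_{ij}] *)
Definition scalar_curvature (nabla : connection) (g : metric) : M -> R :=
  fun p => \tr (invmx (gram g p) *m
    \matrix_(i < n, j < n) ricci nabla (extend p (delta_mx 0 i))
                                       (extend p (delta_mx 0 j)) p).

(** The factor is a function on [M]; for [0 < n] it is necessarily the
    (smooth) function [scalar_curvature / n]. *)
Definition einstein (nabla : connection) (g : metric) : Prop :=
  exists f : M -> R, forall X Y, smooth_vfield X -> smooth_vfield Y ->
    forall p, ricci nabla X Y p = f p * innerf g X Y p.

(** [L_V g], expressed with the statistical connection; it is the Lie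
    derivative of [g] along [V] when [nabla] is the Levi-Civita connection. *)
Definition lie_metric (nabla : connection) (g : metric) (V X Y : vfield) :
    M -> R := fun p =>
  innerf g (nabla X V) Y p + innerf g (nabla Y V) X p.

(** The equation makes sense in every dimension; that solitons have dimension
    at least 3 is left to be assumed separately. *)
Definition ricci_bourguignon_soliton (nabla : connection) (g : metric)
    (V : vfield) (lambda rho : R) : Prop :=
  [/\ smooth_vfield V, rho != 0 &
    forall X Y, smooth_vfield X -> smooth_vfield Y -> forall p,
      2^-1 * lie_metric nabla g V X Y p + ricci nabla X Y p +
      (lambda - rho * scalar_curvature nabla g p) * innerf g X Y p = 0].

End Tangent.

(** * Submersions *)

Section Submersion.
Variables (R : realType) (m n : nat) (M : manifold R m) (N : manifold R n).

Definition smooth_map (psi : M -> N) : Prop :=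
  continuous psi /\
  forall c d, atlas M c -> atlas N d ->
    smooth_on (coord c @` (dom c `&` psi @^-1` dom d))
              (coord d \o psi \o icoord c).

(** The differential [T_p M -> T_(psi p) N]. *)
Definition tmap (psi : M -> N) (p : M) (v : 'rV[R]_m) : 'rV[R]_n :=
  tderive (coord (chart_at (psi p)) \o psi) p v.

Definition vertical (psi : M -> N) (p : M) : set 'rV[R]_m :=
  [set v | tmap psi p v = 0].

Definition horizontal (psi : M -> N) (g : metric M) (p : M) :
    set 'rV[R]_m :=
  [set u | forall v, vertical psi p v -> inner g p u v = 0].

Definition riemannian_submersion (psi : M -> N)
    (g : metric M) (g' : metric N) : Prop :=
  [/\ smooth_map psi,
      forall q, exists p, psi p = q,
      forall p w, exists v, tmap psi p v = w &
      forall p u v, horizontal psi g p u -> horizontal psi g p v ->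
        inner g' (psi p) (tmap psi p u) (tmap psi p v) = inner g p u v].

(** [psi_* X = X']; [X] is projectable if there is such an [X']. *)
Definition related (psi : M -> N) (X : vfield M) (X' : vfield N) : Prop :=
  forall p, tmap psi p (X p) = X' (psi p).

Definition statistical_submersion (psi : M -> N)
    (nabla : connection M) (g : metric M)
    (nabla' : connection N) (g' : metric N) : Prop :=
  riemannian_submersion psi g g' /\
  forall (X Y : vfield M) (X' Y' : vfield N),
    smooth_vfield X -> smooth_vfield Y ->
    smooth_vfield X' -> smooth_vfield Y' ->
    (forall p, horizontal psi g p (X p)) ->
    (forall p, horizontal psi g p (Y p)) ->
    related psi X X' -> related psi Y Y' ->
    related psi (nabla X Y) (nabla' X' Y').

End Submersion.

(* Main.v *)
(** Write [nabla] for the connection of [M]; let [X], [Y] be basic fields and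
    [U] a vertical one. As the horizontal distribution is parallel, comparing
    the two sides of the Codazzi equation
    [(nabla_X g)(U, Y) = (nabla_U g)(X, Y)] gives [g(X, nabla_Y U) = 0], so
    [nabla_Y U] is vertical. Then
    [nabla_U Y = nabla_Y U + [U, Y]] is both vertical and horizontal, hence
    zero, and so is [R(U, X)Y]. The endomorphism [z |-> R(z, X)Y] thus
    kills vertical vectors, has horizontal values and projects to that of [N]:
    the Ricci tensor of [N] pulls back to that of [M] on basic fields. If [V]
    is vertical, [L_V g] vanishes on basic fields and the soliton equation
    becomes the Einstein equation. If [V] is basic, the equation descends to
    [N] with the factor [kappa = lambda - rho R], and tracing it on both sides
    ([nabla V] and [nabla' V'] have the same trace) gives
    [R' = R + kappa (m - n)], which expresses [kappa] through [R'].

    Basic fields have to be produced globally: the horizontal lift is the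
    adjoint of the differential, and it is smooth because a field [X] is smooth
    as soon as all functions [g(X, Z)] are, which is tested on global frames
    obtained with bump functions. *)

Require Import Defs.
From HB Require Import structures.
From mathcomp Require Import all_boot all_order all_algebra.
From mathcomp Require Import all_classical all_reals all_analysis.
From mathcomp Require Import ring lra.
Import Order.TTheory GRing.Theory Num.Theory.
Import numFieldNormedType.Exports.
(* Again: [coord] and [coord_continuous] are shadowed by the libraries. *)
Import Defs.

Set Implicit Arguments.
Unset Strict Implicit.
Unset Printing Implicit Defensive.

Local Open Scope classical_set_scope.
Local Open Scope ring_scope.

(** * Smooth maps between normed spaces *)

Local Notation ndiff := ndifferentiable_on.

Section Calculus.
Variables (R : realType) (E : normedModType R).
Implicit Types (U : set E) (k : nat) (W : normedModType R).

(** The first-order expansion of [f] at [x] is also one of [g], and [diff_unique] then identifies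
    the differential of [g] with that of [f]. *)
Lemma near_eq_differentiable W (f g : E -> W) x :
  (\forall y \near x, f y = g y) -> differentiable f x -> differentiable g x.
Proof.
move=> fg df.
have fgx : f x = g x := nbhs_singleton fg.
have dg : g \o shift x = cst (g x) + 'd f x +o_ 0 id.
  have /diff_locally dfE := df; move: dfE => /eqaddoP dfE.
  apply/eqaddoP => e e0; have {}dfE := dfE e e0.
  near=> y; rewrite -fgx.
  have -> : (g \o shift x - (cst (f x) + 'd f x)) y =
            (f \o shift x - (cst (f x) + 'd f x)) y.
    suff fgy : f (y + x) = g (y + x) by rewrite /GRing.add/= /comp /shift fgy.
    near: y; have := fg; rewrite (near_shift 0 x) subr0.
    by apply: filterS => y; rewrite /= addrC.
  by near: y.
have fc : continuous ('d f x) by exact: diff_continuous.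
by apply/diff_locallyP; rewrite (diff_unique fc dg).
Unshelve. all: by end_near. Qed.

Lemma ndiffS W k U (f : E -> W) : ndiff k.+1 U f -> ndiff k U f.
Proof.
elim: k f => [//|k IH] f [df Df]; split=> // v; exact: IH (Df v).
Qed.

Lemma sub_ndiff W k U U' (f : E -> W) :
  U' `<=` U -> ndiff k U f -> ndiff k U' f.
Proof.
move=> sU; elim: k f => [//|k IH] f [df Df]; split=> [x /sU/df //|v].
exact: IH (Df v).
Qed.

Lemma eq_ndiff W k U (f g : E -> W) : open U ->
  (forall x, U x -> f x = g x) -> ndiff k U f -> ndiff k U g.
Proof.
move=> oU; elim: k f g => [//|k IH] f g fg [df Df].
have nfg x : U x -> \forall y \near x, f y = g y.
  by move=> Ux; apply: filterS fg _; exact: open_nbhs_nbhs.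
split=> [x Ux|v]; first exact: near_eq_differentiable (nfg x Ux) (df x Ux).
by apply: IH (Df v) => x Ux; apply: near_eq_derive; exact: nfg.
Qed.

(** [ndiff] is a pointwise condition: the derivatives involved are those of the total function [f],
    whatever the set. *)
Lemma ndiff_local W k U (f : E -> W) :
  (forall x, U x -> exists2 B : set E, B x & ndiff k B f) -> ndiff k U f.
Proof.
elim: k f => [//|k IH] f H; split=> [x /H[B Bx [df _]]|v]; first exact: df.
by apply: IH => x /H[B Bx [_ Df]]; exists B => //; exact: Df.
Qed.

Lemma ndiff_cst W k U (a : W) : ndiff k U (cst a : E -> W).
Proof.
elim: k a => [//|k IH] a; split=> // v.
rewrite (_ : 'D_v (cst a) = cst 0); first exact: IH.
by apply/funext => x; rewrite derive_cst.
Qed.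

Lemma ndiff_linear W k U (f : {linear E -> W}) : continuous f -> ndiff k U f.
Proof.
case: k => [//|k] fc; have df x : differentiable f x.
  exact: linear_differentiable.
split=> // v; rewrite (_ : 'D_v f = cst (f v)); first exact: ndiff_cst.
by apply/funext => x; rewrite deriveE// diff_lin.
Qed.

Lemma ndiff_id k U : ndiff k U (fun x : E => x).
Proof. by apply: (@ndiff_linear E k U idfun) => y; exact: cvg_id. Qed.

Lemma ndiffD W k U (f g : E -> W) : open U ->
  ndiff k U f -> ndiff k U g -> ndiff k U (fun x => f x + g x).
Proof.
move=> oU; elim: k f g => [//|k IH] f g [df Df] [dg Dg].
split=> [x Ux|v]; first by apply: differentiableD; [exact: df|exact: dg].
apply: (@eq_ndiff _ _ _ (fun x => 'D_v f x + 'D_v g x)) => // [x Ux|].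
  by rewrite deriveD//; apply: diff_derivable; [exact: df|exact: dg].
exact: IH (Df v) (Dg v).
Qed.

(** Scaling is a continuous bilinear map on [R^o * W]; the product rule is the chain rule for its
    composition with the pair [(f, g)]. *)
Lemma differentiable_scale W (f : E -> R^o) (g : E -> W) x :
  differentiable f x -> differentiable g x ->
  differentiable (fun y => f y *: g y) x /\
  forall v, 'D_v (fun y => f y *: g y) x = f x *: 'D_v g x + 'D_v f x *: g x.
Proof.
move=> df dg; pose s : R^o -> W -> W := *:%R.
have sb : bilinear_for
    (GRing.Scale.Law.clone _ _ *:%R _) (GRing.Scale.Law.clone _ _ *:%R _) s.
  split=> [w|a] c x1 x2; first by rewrite /s /= scalerDl scalerA.
  by rewrite /s /= scalerDr !scalerA mulrC.
pose sB := @bilinear_isBilinear.Build R R^o W W _ _ s sb.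
pose sL : {bilinear R^o -> W -> W} := HB.pack s sB.
have sc : continuous (fun p : R^o * W => sL p.1 p.2) by exact: scale_continuous.
have ds := @differentiable_bilin R _ _ _ sL (f x, g x) sc.
have dp := differentiable_pair df dg.
have dfg : differentiable (fun y => f y *: g y) x by exact: differentiable_comp dp ds.
split=> // v; rewrite !deriveE//.
have := congr1 (@^~ v) (diff_comp dp ds); rewrite /comp/= => ->.
have /= -> := congr1 (@^~ v) (diff_pair df dg).
by have /= -> := congr1 (@^~ ('d f x v, 'd g x v)) (@diff_bilin R _ _ _ sL (f x, g x) sc).
Qed.
Lemma ndiffZ W k U (f : E -> R^o) (g : E -> W) : open U ->
  ndiff k U f -> ndiff k U g -> ndiff k U (fun x => f x *: g x).
Proof.
move=> oU; elim: k f g => [//|k IH] f g /[dup] /ndiffS f0 [df Df]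
  /[dup] /ndiffS g0 [dg Dg].
have dfg x Ux := differentiable_scale (df x Ux) (dg x Ux).
split=> [x /dfg[]//|v].
apply: (@eq_ndiff _ _ _ (fun x => f x *: 'D_v g x + 'D_v f x *: g x)) => //.
  by move=> x /dfg[_ ->].
by apply: ndiffD => //; apply: IH => //; [exact: Dg|exact: Df].
Qed.

Lemma ndiffM k U (f g : E -> R^o) : open U ->
  ndiff k U f -> ndiff k U g -> ndiff k U (fun x => f x * g x : R^o).
Proof. exact: ndiffZ. Qed.

(** The derivative of [1/f] is [- (1/f) (1/f) D_v f], a product of functions already known to be [k]
    times differentiable, so the induction closes. *)
Lemma ndiffV k U (f : E -> R^o) : open U -> (forall x, U x -> f x != 0) ->
  ndiff k U f -> ndiff k U (fun x => (f x)^-1 : R^o).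
Proof.
move=> oU nz; elim: k => [//|k IH] /[dup] /ndiffS f0 [df Df].
split=> [x Ux|v]; first by apply: differentiableV; [exact: df|exact: nz].
apply: (@eq_ndiff _ _ _ (fun x => (-1) * ((f x)^-1 * (f x)^-1 * 'D_v f x))) => //.
  move=> x Ux; rewrite deriveV ?nz//; last exact/diff_derivable/df.
  by rewrite expr2 invfM /GRing.scale/=; ring.
apply: ndiffM => //; first exact: ndiff_cst.
by apply: ndiffM => //; [apply: ndiffM => //; exact: IH|exact: Df].
Qed.

Lemma ndiff_sum W (I : Type) (r : seq I) (P : pred I) k U (F : I -> E -> W) :
  open U -> (forall i, P i -> ndiff k U (F i)) ->
  ndiff k U (fun x => \sum_(i <- r | P i) F i x).
Proof.
move=> oU H; elim: r => [|i r IH].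
  by apply: (eq_ndiff oU _ (ndiff_cst _ _ (0 : W))) => // x _; rewrite big_nil.
case Pi : (P i).
  apply: (eq_ndiff oU _ (ndiffD oU (H i Pi) IH)) => // x _.
  by rewrite big_cons Pi.
by apply: (eq_ndiff oU _ IH) => // x _; rewrite big_cons Pi.
Qed.

Lemma differentiable_rV n (F : E -> 'rV[R]_n) x :
  (forall i, differentiable (fun y => F y 0 i : R^o) x) -> differentiable F x.
Proof.
move=> dF; have -> : F = \sum_(i < n) (fun y => F y 0 i *: delta_mx 0 i).
  by apply/funext => y; rewrite fct_sumE -row_sum_delta.
by by apply: differentiable_sum => i; apply: differentiableZl.
Qed.

Lemma differentiable_rV_comp n (F : E -> 'rV[R]_n) x i :
  differentiable F x -> differentiable (fun y => F y 0 i : R^o) x.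
Proof.
move=> dF; apply: (@differentiable_comp _ _ _ _ F (fun v : 'rV[R]_n => v 0 i)) => //.
exact: differentiable_coord.
Qed.

Lemma derive_rV n (F : E -> 'rV[R]_n) x v i :
  differentiable F x -> ('D_v F x) 0 i = 'D_v (fun y => F y 0 i : R^o) x.
Proof. by move=> dF; rewrite derive_mx ?mxE//; exact: diff_derivable. Qed.

Lemma ndiff_rV n k U (F : E -> 'rV[R]_n) : open U ->
  ndiff k U F <-> forall i, ndiff k U (fun x => F x 0 i : R^o).
Proof.
move=> oU; split; elim: k F => [//|k IH] F; last first.
  move=> H; have dF x : U x -> differentiable F x.
    by move=> Ux; apply: differentiable_rV => i; have [d _] := H i; exact: d.
  split=> // v; apply: IH => i; have [_ /(_ v)] := H i.
  by apply: eq_ndiff => // x Ux; rewrite derive_rV//; exact: dF.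
move=> [dF DF] i; split=> [x Ux|v]; first exact/differentiable_rV_comp/dF.
have := IH _ (DF v) i.
by apply: eq_ndiff => // x Ux; rewrite derive_rV//; exact: dF.
Qed.

End Calculus.

Section Composition.
Variables (R : realType) (E : normedModType R) (n : nat).

Lemma derive_comp_rV (W : normedModType R) (g : E -> 'rV[R]_n)
    (f : 'rV[R]_n -> W) x v :
  differentiable g x -> differentiable f (g x) ->
  'D_v (f \o g) x = 'D_('D_v g x) f (g x).
Proof.
move=> dg df; rewrite !deriveE//; last exact: differentiable_comp.
by rewrite diff_comp.
Qed.

Lemma derive_sum_delta (W : normedModType R) (f : 'rV[R]_n -> W) y v :
  differentiable f y -> 'D_v f y = \sum_i v 0 i *: 'D_(delta_mx 0 i) f y.
Proof.
move=> df; rewrite deriveE// {1}(row_sum_delta v) linear_sum.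
by apply: eq_bigr => i _; rewrite linearZ deriveE.
Qed.

(** By the chain rule ['D_v (f \o g)] is the sum of the [('D_v g)_i] times [(d_i f) \o g]. The
    induction keeps [g] fixed and applies to the partial derivatives of [f]. *)
Lemma ndiff_comp (W : normedModType R) k (U : set E) (U' : set 'rV[R]_n)
    (g : E -> 'rV[R]_n)    (f : 'rV[R]_n -> W) :
  open U -> (forall x, U x -> U' (g x)) -> ndiff k U g -> ndiff k U' f ->
  ndiff k U (f \o g).
Proof.
move=> oU gU; elim: k f => [//|k IH] f /[dup] /ndiffS g0 [dg Dg] [df Df].
split=> [x Ux|v].
  by apply: differentiable_comp; [exact: dg|exact/df/gU].
apply: (@eq_ndiff _ _ _ _ _
  (fun x => \sum_i ('D_v g x) 0 i *: ('D_(delta_mx 0 i) f \o g) x)) => //.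
  move=> x Ux; rewrite derive_comp_rV; [|exact: dg|exact/df/gU].
  by rewrite [RHS]derive_sum_delta//; exact/df/gU.
apply: ndiff_sum => // i _; apply: ndiffZ => //.
  by have /(ndiff_rV _ _ oU) H := Dg v; exact: H.
exact: IH g0 (Df _).
Qed.

End Composition.

(** * Smoothness near a point *)

Lemma nbhs_open (T : topologicalType) (x : T) (A : set T) :
  nbhs x A -> exists2 B, open_nbhs x B & B `<=` A.
Proof. by rewrite nbhsE. Qed.

Definition smooth_near (R : realType) (E W : normedModType R) (x : E)
    (f : E -> W) : Prop :=
  exists2 U, open_nbhs x U & smooth_on U f.

Section SmoothNear.
Variables (R : realType) (E : normedModType R).
Implicit Types (U : set E) (W : normedModType R).

Lemma smooth_onP W U (f : E -> W) : open U ->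
  smooth_on U f <-> forall x, U x -> smooth_near x f.
Proof.
move=> oU; split=> [sf x Ux|H k]; first by exists U.
by apply: ndiff_local => x /H[B [oB Bx] sB]; exists B.
Qed.

Lemma smooth_near_near W (x : E) (f : E -> W) :
  smooth_near x f -> \forall y \near x, smooth_near y f.
Proof.
move=> [U [oU Ux] sf]; apply: filterS (open_nbhs_nbhs (conj oU Ux)) => y Uy.
by exists U.
Qed.

Lemma eq_smooth_near W (x : E) (f g : E -> W) :
  (\forall y \near x, f y = g y) -> smooth_near x f -> smooth_near x g.
Proof.
move=> fg [U Ux sf].
have [V [oV Vx] sV] := nbhs_open (filterI fg (open_nbhs_nbhs Ux)).
exists V => // k; apply: (eq_ndiff oV (f := f)) => [y /sV[]//|].
by apply: sub_ndiff (sf k) => y /sV[].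
Qed.

Lemma smooth_near_differentiable W (x : E) (f : E -> W) :
  smooth_near x f -> differentiable f x.
Proof. by move=> [U [_ Ux] sf]; have [d _] := sf 1%N; exact: d. Qed.

Lemma smooth_near_continuous W (x : E) (f : E -> W) :
  smooth_near x f -> {for x, continuous f}.
Proof. by move=> /smooth_near_differentiable; exact: differentiable_continuous. Qed.

Lemma smooth_near_derive W (x : E) (f : E -> W) v :
  smooth_near x f -> smooth_near x ('D_v f).
Proof. by move=> [U Ux sf]; exists U => // k; have [_ d] := sf k.+1; exact: d. Qed.

Lemma smooth_near_cst W (x : E) (a : W) : smooth_near x (cst a).
Proof.
by exists setT => [|k]; [split=> //; exact: openT|exact: ndiff_cst].
Qed.

Lemma smooth_near_id (x : E) : smooth_near x (fun y : E => y).
Proof. by exists setT => [|k]; [split=> //; exact: openT|exact: ndiff_id]. Qed.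

Lemma smooth_near2 W1 W2 W3 (x : E) (f : E -> W1) (g : E -> W2) (h : E -> W3) :
  (forall k U, open U -> ndiff k U f -> ndiff k U g -> ndiff k U h) ->
  smooth_near x f -> smooth_near x g -> smooth_near x h.
Proof.
move=> H [U [oU Ux] sf] [V [oV Vx] sg]; exists (U `&` V).
  by split; [exact: openI|].
by move=> k; apply: H; [exact: openI|exact: sub_ndiff (sf k)|exact: sub_ndiff (sg k)].
Qed.

Lemma smooth_nearD W (x : E) (f g : E -> W) :
  smooth_near x f -> smooth_near x g -> smooth_near x (fun y => f y + g y).
Proof. by apply: smooth_near2 => k U oU; exact: ndiffD. Qed.

Lemma smooth_nearZ W (x : E) (f : E -> R^o) (g : E -> W) :
  smooth_near x f -> smooth_near x g -> smooth_near x (fun y => f y *: g y).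
Proof. by apply: smooth_near2 => k U oU; exact: ndiffZ. Qed.

Lemma smooth_nearM (x : E) (f g : E -> R^o) :
  smooth_near x f -> smooth_near x g -> smooth_near x (fun y => f y * g y : R^o).
Proof. exact: smooth_nearZ. Qed.

Lemma smooth_nearV (x : E) (f : E -> R^o) : f x != 0 ->
  smooth_near x f -> smooth_near x (fun y => (f y)^-1 : R^o).
Proof.
move=> fx sf; have fc := smooth_near_continuous sf.
have nz : \forall y \near x, f y != 0.
  exact: (cvgr_neq0 (V := R^o) (f x) fc fx).
have [U Ux sU] := sf.
have [V [oV Vx] sV] := nbhs_open (filterI nz (open_nbhs_nbhs Ux)).
exists V => // k; apply: ndiffV => // [y /sV[]//|].
by apply: sub_ndiff (sU k) => y /sV[].
Qed.

Lemma smooth_near_sum W (I : eqType) (r : seq I) (x : E) (F : I -> E -> W) :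
  (forall i, i \in r -> smooth_near x (F i)) ->
  smooth_near x (fun y => \sum_(i <- r) F i y).
Proof.
elim: r => [_|i r IH H].
  apply: eq_smooth_near (smooth_near_cst x (0 : W)).
  by near=> y; rewrite big_nil.
have Hi : smooth_near x (F i) by apply: H; rewrite mem_head.
have Hr : smooth_near x (fun y => \sum_(j <- r) F j y).
  by apply: IH => j jr; apply: H; rewrite inE jr orbT.
apply: eq_smooth_near (smooth_nearD Hi Hr).
by near=> y; rewrite big_cons.
Unshelve. all: by end_near. Qed.

Lemma smooth_near_prod (I : eqType) (r : seq I) (x : E) (F : I -> E -> R^o) :
  (forall i, i \in r -> smooth_near x (F i)) ->
  smooth_near x (fun y => \prod_(i <- r) F i y : R^o).
Proof.
elim: r => [_|i r IH H].
  apply: eq_smooth_near (smooth_near_cst x (1 : R^o)).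
  by near=> y; rewrite big_nil.
have Hi : smooth_near x (F i) by apply: H; rewrite mem_head.
have Hr : smooth_near x (fun y => \prod_(j <- r) F j y : R^o).
  by apply: IH => j jr; apply: H; rewrite inE jr orbT.
apply: eq_smooth_near (smooth_nearM Hi Hr).
by near=> y; rewrite big_cons.
Unshelve. all: by end_near. Qed.

Lemma smooth_near_rV n (x : E) (F : E -> 'rV[R]_n) :
  smooth_near x F <-> forall i, smooth_near x (fun y => F y 0 i : R^o).
Proof.
split=> [[U Ux sF] i|H].
  exists U => // k; have [oU _] := Ux.
  by have /(ndiff_rV _ _ oU) H := sF k; exact: H.
pose U i := projT1 (cid2 (H i)).
have HU i : open_nbhs x (U i) /\ smooth_on (U i) (fun y => F y 0 i : R^o).
  by rewrite /U; case: cid2.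
have : \forall y \near x, forall i, U i y.
  by apply: filter_forall => i; apply: open_nbhs_nbhs; have [] := HU i.
move=> /nbhs_open[V [oV Vx] sV]; exists V => // k.
apply/ndiff_rV => // i; have [_ /(_ k)] := HU i.
by apply: sub_ndiff => y /sV.
Qed.

Lemma smooth_near_det n (x : E) (A : E -> 'M[R]_n) :
  (forall i j, smooth_near x (fun y => A y i j : R^o)) ->
  smooth_near x (fun y => \det (A y) : R^o).
Proof.
move=> H; apply: smooth_near_sum => s _; apply: smooth_nearM.
  exact: smooth_near_cst.
by apply: smooth_near_prod => i _; exact: H.
Qed.

(** Cramer's rule: the determinant stays nonzero near [x], where [invmx] is therefore the adjugate
    over the determinant and not its default value. *)
Lemma smooth_near_invmx n (x : E) (A : E -> 'M[R]_n) i j :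
  A x \in unitmx ->
  (forall i j, smooth_near x (fun y => A y i j : R^o)) ->
  smooth_near x (fun y => invmx (A y) i j : R^o).
Proof.
move=> Au H; have sdet := smooth_near_det H.
have dx : \det (A x) != 0 by move: Au; rewrite unitmxE unitfE.
have nz : \forall y \near x, \det (A y) != 0.
  exact: (cvgr_neq0 (V := R^o) _ (smooth_near_continuous sdet) dx).
apply: (@eq_smooth_near _ _ (fun y => (\det (A y))^-1 * (\adj (A y)) i j)).
  near=> y.
  have -> : invmx (A y) = (\det (A y))^-1 *: \adj (A y).
    by rewrite /invmx unitmxE unitfE ifT//; near: y.
  by rewrite [in RHS]mxE.
apply: smooth_nearM; first exact: smooth_nearV.
rewrite (_ : (fun y => _) = fun y => cofactor (A y) j i); last first.
  by apply/funext => y; rewrite mxE.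
apply: smooth_nearM; first exact: smooth_near_cst.
apply: smooth_near_det => k l.
by rewrite (_ : (fun y => _) = fun y => A y (lift j k) (lift i l))//;
  apply/funext => y; rewrite !mxE.
Unshelve. all: by end_near. Qed.

End SmoothNear.

Section SmoothNearComp.
Variables (R : realType) (E : normedModType R) (n : nat).

Lemma smooth_near_comp (W : normedModType R) (x : E)
    (g : E -> 'rV[R]_n) (f : 'rV[R]_n -> W) :
  smooth_near x g -> smooth_near (g x) f -> smooth_near x (f \o g).
Proof.
move=> sg [U' [oU' U'x] sf].
have gc := smooth_near_continuous sg.
have [U Ux sU] := sg.
have : \forall y \near x, U' (g y) /\ U y.
  apply: filterI (open_nbhs_nbhs Ux).
  by apply: gc; exact: open_nbhs_nbhs.
move=> /nbhs_open[V [oV Vx] sV]; exists V => // k.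
apply: (ndiff_comp oV (U' := U')) => // [y /sV[]//|].
by apply: sub_ndiff (sU k) => y /sV[].
Qed.

End SmoothNearComp.

(** * Symmetry of second derivatives *)

Lemma distm_le_half (R : realFieldType) (p q c e : R) :
  `|p - c| < e / 2 -> `|q - c| < e / 2 -> `|p - q| <= e.
Proof.
move=> pc qc; rewrite [e]splitr ltW// -(subrKA c).
by rewrite (le_lt_trans (ler_normD _ _))// ltrD// distrC.
Qed.

Section Schwarz.
Variables (R : realType) (E : normedModType R).

Lemma MVT_line (g : E -> R^o) (a u : E) (t : R) : 0 < t ->
  (forall s, 0 <= s <= t -> differentiable g (a + s *: u)) ->
  exists2 c, 0 <= c <= t & g (a + t *: u) - g a = t * 'D_u g (a + c *: u).
Proof.
move=> t0 dg; pose h (s : R) := g (a + s *: u).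
have dh s : 0 <= s <= t -> is_derive s 1 h ('D_u g (a + s *: u)).
  move=> /dg {}dg.
  have d1 : is_diff s (fun s : R => a + s *: u) ( *:%R ^~ u).
    by apply: is_diff_eq; rewrite add0r.
  have dgs : differentiable g (a + s *: u) by [].
  have dhs : differentiable h s.
    by apply: (differentiable_comp (f := fun s : R => a + s *: u)).
  apply: DeriveDef; first exact: diff_derivable.
  rewrite deriveE// (@diff_comp _ _ _ _ (fun s : R => a + s *: u) g)//=.
  by rewrite diff_val scale1r deriveE.
have h1 : forall x, x \in `]0, t[ -> is_derive x 1 h ('D_u g (a + x *: u)).
  by move=> x; rewrite in_itv/= => /andP[x0 xt]; apply: dh; rewrite !ltW.
have h2 : {within `[0, t], continuous h}.
  apply: derivable_within_continuous => x; rewrite in_itv/= => xt.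
  by have [] := dh _ xt.
have [c] := MVT_segment (ltW t0) h1 h2.
rewrite in_itv/= => ct; rewrite /h scale0r addr0 subr0 mulrC => ?.
by exists c.
Qed.

(** Two mean value arguments: one for [y |-> f (y + t v) - f y] along [u], then one for ['D_u f]
    along [v]. *)
Lemma derive_second_difference (f : E -> R^o) (x u v : E) (t : R) : 0 < t ->
  (forall a b, 0 <= a <= t -> 0 <= b <= t ->
     differentiable f (x + a *: u + b *: v) /\
     differentiable ('D_u f) (x + a *: u + b *: v)) ->
  exists a b, [/\ 0 <= a <= t, 0 <= b <= t &
    f (x + t *: u + t *: v) - f (x + t *: u) - f (x + t *: v) + f x =
    t * (t * 'D_v ('D_u f) (x + a *: u + b *: v))].
Proof.
move=> t0 H; pose g y := f (y + t *: v) - f y : R^o.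
have tt : 0 <= t <= t by rewrite (ltW t0) lexx.
have t00 : 0 <= (0 : R) <= t by rewrite lexx (ltW t0).
have Hd a : 0 <= a <= t -> is_diff (x + a *: u) g
    (fun w => 'd f (x + a *: u + t *: v) w - 'd f (x + a *: u) w).
  move=> at0; have [d1 _] := H a t at0 tt; have [d2 _] := H a 0 at0 t00.
  rewrite scale0r addr0 in d2.
  have /differentiableP i1 := d1; have /differentiableP i2 := d2.
  have i3 : is_diff (x + a *: u) (fun y => y + t *: v) id.
    by apply: is_diff_eq; rewrite addr0.
  exact: is_diff_eq.
have [a at0 Ea] := @MVT_line g x u t t0 (fun s st => @ex_diff _ _ _ _ _ _ _ (Hd s st)).
have [b bt0 Eb] := @MVT_line ('D_u f) (x + a *: u) v t t0 (fun s st => (H a s at0 st).2).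
exists a, b; split=> //; rewrite -Eb.
have -> : 'D_u f (x + a *: u + t *: v) - 'D_u f (x + a *: u) = 'D_u g (x + a *: u).
  have [d1 _] := H a t at0 tt; have [d2 _] := H a 0 at0 t00.
  rewrite scale0r addr0 in d2; have ig := Hd a at0.
  by rewrite !deriveE// [in RHS]diff_val.
by rewrite -Ea /g; ring.
Qed.

(** The second difference is symmetric in [u] and [v], so the two mixed derivatives agree at some
    pair of points arbitrarily close to [x]; their continuity moves the equality to [x] up to any
    [e]. *)
Lemma smooth_near_deriveC (f : E -> R^o) (x u v : E) :
  smooth_near x f -> 'D_u ('D_v f) x = 'D_v ('D_u f) x.
Proof.
move=> sf; apply/eqP; rewrite -subr_eq0 -normr_le0; apply/ler_addgt0Pl => e e0.
rewrite addr0.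
have c1 := smooth_near_continuous (smooth_near_derive u (smooth_near_derive v sf)).
have c2 := smooth_near_continuous (smooth_near_derive v (smooth_near_derive u sf)).
have e2 : 0 < e / 2 by rewrite divr_gt0.
have n1 : \forall y \near x, `|'D_u ('D_v f) x - 'D_u ('D_v f) y| < e / 2.
  by move/cvgrPdist_lt : c1 => H; exact: (H _ e2).
have n2 : \forall y \near x, `|'D_v ('D_u f) x - 'D_v ('D_u f) y| < e / 2.
  by move/cvgrPdist_lt : c2 => H; exact: (H _ e2).
have := filterI (smooth_near_near sf) (filterI n1 n2).
rewrite nbhs_ballP => -[r /= r0 rH].
(* This makes [t (|u| + |v|) < r], so the whole parallelogram lies in the ball; the [+ 1] covers
   [u = v = 0]. *)
pose t := r / (2 * (`|u| + `|v| + 1)).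
have uv0 : 0 < `|u| + `|v| + 1 by rewrite ltr_wpDl// addr_ge0.
have t0 : 0 < t by rewrite divr_gt0// mulr_gt0.
have inb a b : 0 <= a <= t -> 0 <= b <= t -> ball x r (x + a *: u + b *: v).
  move=> /andP[a0 at0] /andP[b0 bt0]; rewrite -ball_normE/=.
  rewrite -addrA opprD addrA subrr sub0r normrN.
  apply: (@le_lt_trans _ _ (t * `|u| + t * `|v|)).
    rewrite (le_trans (ler_normD _ _))// !normrZ !ger0_norm//.
    by rewrite lerD// ler_wpM2r.
  rewrite -mulrDr /t -[X in X < _]mulrA.
  rewrite -[X in _ < X]mulr1 ltr_pM2l// mulrC ltr_pdivrMr ?mulr_gt0// mul1r.
  by have := normr_ge0 u; have := normr_ge0 v; lra.
have Hs a b : 0 <= a <= t -> 0 <= b <= t -> smooth_near (x + a *: u + b *: v) f.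
  by move=> at0 bt0; have [] := rH _ (inb a b at0 bt0).
have [a [b [at0 bt0 E1]]] : exists a b, [/\ 0 <= a <= t, 0 <= b <= t &
    f (x + t *: u + t *: v) - f (x + t *: u) - f (x + t *: v) + f x =
    t * (t * 'D_v ('D_u f) (x + a *: u + b *: v))].
  apply: derive_second_difference => // a b at0 bt0.
  have sab := Hs a b at0 bt0; split; first exact: smooth_near_differentiable.
  exact/smooth_near_differentiable/smooth_near_derive.
have [a' [b' [at0' bt0' E2]]] : exists a b, [/\ 0 <= a <= t, 0 <= b <= t &
    f (x + t *: v + t *: u) - f (x + t *: v) - f (x + t *: u) + f x =
    t * (t * 'D_u ('D_v f) (x + a *: v + b *: u))].
  apply: derive_second_difference => // a' b' at0' bt0'.
  have sab := Hs b' a' bt0' at0'; rewrite addrAC.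
  split; first exact: smooth_near_differentiable.
  exact/smooth_near_differentiable/smooth_near_derive.
have E3 : 'D_v ('D_u f) (x + a *: u + b *: v) = 'D_u ('D_v f) (x + b' *: u + a' *: v).
  have tn : t != 0 by rewrite gt_eqF.
  apply: (mulfI tn); apply: (mulfI tn); rewrite (addrAC x (b' *: u)).
  apply: (etrans (esym E1)); apply: etrans E2.
  by rewrite (addrAC x (t *: v)); congr (_ + _); exact: addrAC.
have [_ [_ /= N2]] := rH _ (inb a b at0 bt0).
have [_ [/= N1 _]] := rH _ (inb b' a' bt0' at0').
exact: distm_le_half N1 (eq_ind _ (fun z => `|_ - z| < e / 2) N2 _ E3).
Qed.

End Schwarz.

(** * Bump functions *)

Section Bump.
Variable R : realType.

(** Each monomial is bounded by a term of the exponential series, [s^i <= i! exp s], whence the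
    constant. *)
Lemma poly_le_expR (p : {poly R}) :
  exists C, forall s, 0 <= s -> `|p.[s]| <= C * expR s.
Proof.
exists (\sum_(i < size p) `|p`_i| * (i`!)%:R) => s s0.
rewrite horner_coef mulr_suml (le_trans (ler_norm_sum _ _ _))// ler_sum// => i _.
rewrite normrM normrX (ger0_norm s0) -mulrA ler_wpM2l//.
case: (nat_of_ord i) => [|k].
  by rewrite expr0 fact0 mul1r (le_trans _ (expR_ge1Dx _))// lerDl.
rewrite mulrC -ler_pdivrMr ?ltr0n ?fact_gt0//.
by rewrite (le_trans _ (expR_ge1Dxn k s0))// lerDr.
Qed.

(** This family is stable under differentiation, so its members are smooth. *)
Definition exp_inv (p : {poly R}) (t : R) : R :=
  if 0 < t then p.[t^-1] * expR (- t^-1) else 0.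

(** Flatness at 0, from [poly_le_expR] for [X^2 p] at [1/t]. Order two makes the difference quotient
    at 0 tend to 0. *)
Lemma exp_inv_bound (p : {poly R}) :
  exists C, 0 <= C /\ forall t, `|exp_inv p t| <= C * `|t| * `|t|.
Proof.
have [C HC] := poly_le_expR ('X * ('X * p)).
have C0 : 0 <= C.
  have := HC 0 (lexx _); rewrite expR0 mulr1; exact/le_trans/normr_ge0.
exists C; split=> // t; rewrite /exp_inv; case: ltP => t0; last first.
  by rewrite normr0 !mulr_ge0.
have it : 0 < t^-1 by rewrite invr_gt0.
have := HC _ (ltW it).
rewrite !hornerM hornerX !normrM (gtr0_norm it) (gtr0_norm t0) => H.
rewrite [`|expR _|]gtr0_norm ?expR_gt0// expRN ler_pdivrMr ?expR_gt0//.
have t2 : 0 <= t * t by rewrite mulr_ge0 ?ltW.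
have := ler_wpM2l t2 H.
have tn : t != 0 by rewrite gt_eqF.
rewrite (_ : t * t * (t^-1 * (t^-1 * `|p.[t^-1]|)) = `|p.[t^-1]|); last first.
  by field.
by rewrite (_ : t * t * (C * expR t^-1) = C * t * t * expR t^-1)//; ring.
Qed.

Lemma exp_inv_le0 p t : t <= 0 -> exp_inv p t = 0.
Proof. by rewrite /exp_inv ltNge => ->. Qed.

Lemma exp_inv_gt0 p t : 0 < t -> exp_inv p t = p.[t^-1] * expR (- t^-1).
Proof. by rewrite /exp_inv => ->. Qed.

Lemma is_derive_exp_inv (p : {poly R}) (t : R) :
  is_derive t 1 (exp_inv p : R -> R^o) (exp_inv ('X^2 * (p - p^`())) t).
Proof.
case: (ltgtP t 0) => t0.
- rewrite [X in is_derive _ _ _ X]exp_inv_le0 ?ltW//.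
  apply: (near_eq_is_derive (f := cst (0 : R^o))).
  near=> s; rewrite exp_inv_le0// ltW//; near: s; exact: lt_nbhsl.
- rewrite [X in is_derive _ _ _ X]exp_inv_gt0//.
  apply: (near_eq_is_derive (f := (fun s => p.[s^-1] * expR (- s^-1)) : R -> R^o)).
    near=> s; rewrite exp_inv_gt0//; near: s; exact: lt_nbhsr.
  have tn : t != 0 by rewrite gt_eqF.
  have di : is_derive t 1 (fun s : R => s^-1) (- t ^- 2).
    apply: DeriveDef; first exact: derivableV.
    by rewrite (deriveV (f := id))// derive_id /GRing.scale/= mulr1.
  have dp : is_derive t 1 (fun s : R => p.[s^-1]) ((p^`()).[t^-1] * - t ^- 2).
    exact: (is_derive1_comp (f := horner p)).
  have de : is_derive t 1 (fun s : R => expR (- s^-1)) (expR (- t^-1) * t ^- 2).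
    have dn : is_derive t 1 (fun s : R => - s^-1) (t ^- 2).
      by have := is_deriveN di; rewrite opprK.
    exact: (is_derive1_comp (f := expR) (g := fun s => - s^-1) (is_derive_expR _) dn).
  apply: (is_derive_eq (is_deriveM dp de)).
  by rewrite /GRing.scale/= !hornerE/= -exprVn; ring.
- rewrite t0 [X in is_derive _ _ _ X]exp_inv_le0//.
  have [C [C0 HC]] := exp_inv_bound p.
  have H : (fun h : R => h^-1 *: (exp_inv p (h *: 1 + 0) - exp_inv p 0 : R^o)) @
      0^' --> (0 : R^o).
    apply/cvgrPdist_le => e e0.
    (* [C] may vanish, so [e] is divided by [C + 1]. *)
    have C1 : 0 < C + 1 by rewrite ltr_wpDl.
    have eC : 0 < e / (C + 1) by rewrite divr_gt0.
    near=> h.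
    rewrite sub0r normrN addr0 (exp_inv_le0 _ (lexx _)) subr0 /GRing.scale/= mulr1.
    have hn : h != 0 by near: h; exact: nbhs_dnbhs_neq.
    rewrite normrM normfV mulrC ler_pdivrMr ?normr_gt0//.
    apply: (le_trans (HC h)); rewrite ler_wpM2r//.
    have : `|h| <= e / (C + 1).
      near: h; exact: (dnbhs0_le (V := R^o) eC).
    rewrite ler_pdivlMr// => /(le_trans _); apply.
    by rewrite mulrC ler_wpM2l// lerDl.
  apply: DeriveDef; first by apply/cvg_ex; exists 0.
  exact: (cvg_lim _ H).
Unshelve. all: by end_near.
Qed.

Lemma ndiff_exp_inv (E : normedModType R) k (U : set E) (p : {poly R})
    (g : E -> R^o) :
  open U -> ndiff k U g -> ndiff k U (fun x => exp_inv p (g x) : R^o).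
Proof.
move=> oU; elim: k p => [//|k IH] p /[dup] /ndiffS g0 [dg Dg].
have df t : differentiable (exp_inv p : R -> R^o) t.
  by apply/derivable1_diffP; have [] := is_derive_exp_inv p t.
split=> [x Ux|v].
  by apply: (differentiable_comp (f := g) (g := exp_inv p)) => //; exact: dg.
apply: (@eq_ndiff _ _ _ _ _
  (fun x => 'D_v g x * exp_inv ('X^2 * (p - p^`())) (g x) : R^o)) => //.
  move=> x Ux; have dgx := dg x Ux.
  rewrite [RHS]deriveE; last exact: (differentiable_comp (f := g) (g := exp_inv p)).
  rewrite (diff_comp (f := g) (g := exp_inv p))//= diff1E// -deriveE// derive1E.
  by have /@derive_val -> := is_derive_exp_inv p (g x).
by apply: ndiffM => //; [exact: Dg|exact: IH].
Qed.

(** The bump is [exp(-1/s)], normalised at [x0], with [s = (r/2)^2 - |x - x0|^2] for the Euclidean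
    norm: unlike the sup norm of ['rV_n], its square is a polynomial. *)
Lemma smooth_bump n (x0 : 'rV[R]_n) (U : set 'rV[R]_n) : nbhs x0 U ->
  exists (b : 'rV[R]_n -> R^o) (K : set 'rV[R]_n),
    [/\ smooth_on setT b, b x0 = 1, compact K, K `<=` U &
        forall x, ~ K x -> b x = 0].
Proof.
rewrite nbhs_ballP => -[r /= r0 rU].
pose s (x : 'rV[R]_n) : R^o := (r / 2) ^+ 2 - \sum_i (x 0 i - x0 0 i) * (x 0 i - x0 0 i).
have s0 : s x0 = (r / 2) ^+ 2.
  by rewrite /s big1 ?subr0// => i _; rewrite subrr mulr0.
have r2 : 0 < r / 2 by rewrite divr_gt0.
have e0 : exp_inv 1 (s x0) != 0.
  by rewrite s0 exp_inv_gt0 ?exprn_gt0// hornerC mul1r gt_eqF// expR_gt0.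
exists (fun x => exp_inv 1 (s x) * (exp_inv 1 (s x0))^-1).
(* The closed cube contains the Euclidean ball where [s] is positive, is compact as a product of
   segments, and lies in the sup-norm ball of radius [r]. *)
exists [set x | forall i, x 0 i \in `[x0 0 i - r / 2, x0 0 i + r / 2] ].
split.
- move=> k; have oT : open (@setT 'rV[R]_n) := openT.
  apply: ndiffM => //; last exact: ndiff_cst.
  apply: ndiff_exp_inv => //; apply: ndiffD => //; first exact: ndiff_cst.
  rewrite (_ : (fun _ => _) = fun x : 'rV[R]_n =>
      \sum_i (- 1 * ((x 0 i - x0 0 i) * (x 0 i - x0 0 i)))); last first.
    by apply/funext => x; rewrite -mulr_sumr mulN1r.
  apply: ndiff_sum => // i _; apply: ndiffM => //; first exact: ndiff_cst.
  have sc : ndiff k setT (fun x : 'rV[R]_n => x 0 i - x0 0 i : R^o).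
    apply: ndiffD => //; last exact: ndiff_cst.
    by have /(ndiff_rV _ _ oT) H := @ndiff_id R 'rV[R]_n k setT; exact: H.
  exact: ndiffM.
- by rewrite mulfV.
- apply: (@rV_compact _ _ (fun i => `[x0 0 i - r / 2, x0 0 i + r / 2]%classic)).
  by move=> i; exact: segment_compact.
- move=> x Kx; apply: rU; split=> // i j.
  rewrite ord1 /ball/= distrC; have := Kx j; rewrite in_itv/=.
  by rewrite -ler_distl => /le_lt_trans; apply; rewrite ltr_pdivrMr// ltr_pMr// ltr1n.
- move=> x Kx; rewrite exp_inv_le0 ?mul0r// leNgt; apply/negP => sx; apply: Kx => i.
  rewrite in_itv/= -ler_distl -ler_sqr ?nnegrE ?(ltW r2)//.
  move: sx; rewrite /s subr_gt0 => /ltW; apply: le_trans.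
  rewrite (bigD1 i)//= real_normK ?num_real// -expr2 lerDl sumr_ge0// => j _.
  by rewrite -expr2 sqr_ge0.
Qed.

End Bump.

(** * Calculus in charts *)

Section DirectionalDerivative.
Variables (R : realType) (n : nat).

Lemma smooth_near_derive_along (W : normedModType R) (x : 'rV[R]_n)
    (X : 'rV[R]_n -> 'rV[R]_n) (F : 'rV[R]_n -> W) :
  smooth_near x X -> smooth_near x F ->
  smooth_near x (fun y => 'D_(X y) F y).
Proof.
move=> sX sF.
apply: (@eq_smooth_near _ _ _ _ (fun y => \sum_i X y 0 i *: 'D_(delta_mx 0 i) F y)).
  apply: filterS (smooth_near_near sF) => y sy.
  by rewrite -derive_sum_delta//; exact: smooth_near_differentiable.
apply: smooth_near_sum => i _; apply: smooth_nearZ.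
  by move/smooth_near_rV : sX; apply.
exact: smooth_near_derive.
Qed.

Lemma derive_linear (E W : normedModType R) (x : E) (F : E -> W) a u v :
  differentiable F x -> 'D_(a *: u + v) F x = a *: 'D_u F x + 'D_v F x.
Proof. by move=> dF; rewrite !deriveE// linearP. Qed.

End DirectionalDerivative.

Section Charts.
Variables (R : realType) (n : nat) (M : manifold R n).
Implicit Types (c d : chart R n M) (p q : M) (W : normedModType R).

Lemma near_dom c p : dom c p -> \forall q \near p, dom c q.
Proof. by move=> cp; apply: open_nbhs_nbhs; split=> //; exact: dom_open. Qed.

Lemma near_coord c p (B : set 'rV[R]_n) : dom c p -> nbhs (coord c p) B ->
  \forall q \near p, B (coord c q).
Proof. by move=> cp; exact: (coord_continuous cp). Qed.

Lemma near_icoord c p (A : set M) : dom c p -> nbhs p A ->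
  \forall y \near coord c p, A (icoord c y).
Proof.
by move=> cp pA; apply: (icoord_continuous cp); rewrite coordK.
Qed.

Lemma near_image c p : dom c p -> \forall y \near coord c p, (coord c @` dom c) y.
Proof.
move=> cp; apply: open_nbhs_nbhs; split; first exact: image_open.
by exists p.
Qed.

Lemma near_icoordK c p : dom c p ->
  \forall y \near coord c p, dom c (icoord c y) /\ coord c (icoord c y) = y.
Proof.
by move=> cp; apply: filterS (near_image cp) => _ [q cq <-]; rewrite coordK.
Qed.

Lemma open_coord_image c (A : set M) : open A -> open (coord c @` (dom c `&` A)).
Proof.
move=> oA; rewrite openE => _ [p [cp Ap] <-].
have nA : nbhs p A by apply: open_nbhs_nbhs.
rewrite /interior /=; apply: filterS2 (near_icoordK cp) (near_icoord cp nA).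
by move=> y [dy yE] Ay; exists (icoord c y).
Qed.

Lemma smooth_transition c d p : atlas M c -> atlas M d -> dom c p -> dom d p ->
  smooth_near (coord c p) (coord d \o icoord c).
Proof.
move=> ac ad cp dp; exists (coord c @` (dom c `&` dom d)).
  by split; [apply: open_coord_image; exact: dom_open|exists p].
exact: atlas_compat.
Qed.

(** Pointwise smoothness, read in the preferred chart; [msmoothE] frees it from this choice. *)
Definition msmooth W (p : M) (F : M -> W) : Prop :=
  smooth_near (coord (chart_at p) p) (F \o icoord (chart_at p)).

Lemma smooth_near_chart W c d p (F : M -> W) :
  atlas M c -> atlas M d -> dom c p -> dom d p ->
  smooth_near (coord c p) (F \o icoord c) ->
  smooth_near (coord d p) (F \o icoord d).
Proof.
move=> ac ad cp dp sF.
apply: (@eq_smooth_near _ _ _ _ ((F \o icoord c) \o (coord c \o icoord d))).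
  have nd := near_icoord dp (near_dom cp).
  by apply: filterS nd => y cy; rewrite /= coordK.
apply: smooth_near_comp; first exact: smooth_transition.
by rewrite /= coordK.
Qed.

Lemma msmoothE W c p (F : M -> W) : atlas M c -> dom c p ->
  msmooth p F <-> smooth_near (coord c p) (F \o icoord c).
Proof.
move=> ac cp; have ap := chart_at_atlas p; have dp := chart_at_dom p.
by split; exact: smooth_near_chart.
Qed.

Lemma eq_msmooth W p (F G : M -> W) :
  (\forall q \near p, F q = G q) -> msmooth p F -> msmooth p G.
Proof.
move=> FG; apply: eq_smooth_near.
exact: near_icoord (chart_at_dom p) FG.
Qed.

Lemma near_msmooth W p (F : M -> W) : msmooth p F -> \forall q \near p, msmooth q F.
Proof.
have dp := chart_at_dom p; have ap := chart_at_atlas p.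
move=> /smooth_near_near/(near_coord dp); apply: filterS2 (near_dom dp).
by move=> q dq; move=> ?; apply/(msmoothE _ ap dq).
Qed.

Lemma msmooth_continuous W p (F : M -> W) : msmooth p F -> {for p, continuous F}.
Proof.
have dp := chart_at_dom p.
move=> /smooth_near_continuous sF A; rewrite -{1}(coordK dp) => FA.
have := near_coord dp (sF _ FA); apply: filterS2 (near_dom dp) => q dq /=.
by rewrite coordK.
Qed.

Lemma msmooth_cst W p (a : W) : msmooth p (cst a : M -> W).
Proof. exact: smooth_near_cst. Qed.

Lemma msmoothD W p (F G : M -> W) :
  msmooth p F -> msmooth p G -> msmooth p (fun q => F q + G q).
Proof. exact: smooth_nearD. Qed.

Lemma msmoothZ W p (f : M -> R^o) (F : M -> W) :
  msmooth p f -> msmooth p F -> msmooth p (fun q => f q *: F q).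
Proof. exact: smooth_nearZ. Qed.

Lemma msmoothM p (f g : M -> R^o) :
  msmooth p f -> msmooth p g -> msmooth p (fun q => f q * g q : R^o).
Proof. exact: smooth_nearM. Qed.

Lemma msmoothV p (f : M -> R^o) : f p != 0 ->
  msmooth p f -> msmooth p (fun q => (f q)^-1 : R^o).
Proof.
by move=> fp; apply: smooth_nearV; rewrite /= coordK//; exact: chart_at_dom.
Qed.

Lemma msmooth_sum W (I : eqType) (r : seq I) p (F : I -> M -> W) :
  (forall i, i \in r -> msmooth p (F i)) ->
  msmooth p (fun q => \sum_(i <- r) F i q).
Proof. exact: smooth_near_sum. Qed.

Lemma msmooth_rV k p (F : M -> 'rV[R]_k) :
  msmooth p F <-> forall i, msmooth p (fun q => F q 0 i : R^o).
Proof. exact: smooth_near_rV. Qed.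

Lemma msmooth_invmx k p (A : M -> 'M[R]_k) i j : A p \in unitmx ->
  (forall i j, msmooth p (fun q => A q i j : R^o)) ->
  msmooth p (fun q => invmx (A q) i j : R^o).
Proof.
by move=> Au; apply: (@smooth_near_invmx _ _ _ _ (A \o icoord (chart_at p)));
  rewrite /= coordK//; exact: chart_at_dom.
Qed.

Lemma msmooth_coord c p : atlas M c -> dom c p -> msmooth p (coord c).
Proof.
move=> ac cp; apply/(msmoothE _ ac cp); apply: eq_smooth_near (@smooth_near_id _ _ _).
by apply: filterS (near_icoordK cp) => y [_ /= ->].
Qed.

Lemma msmooth_comp W k p (F : M -> 'rV[R]_k) (h : 'rV[R]_k -> W) :
  msmooth p F -> smooth_near (F p) h -> msmooth p (h \o F).
Proof.
move=> sF sh; apply: (smooth_near_comp (g := F \o icoord (chart_at p))) => //.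
by rewrite /= coordK//; exact: chart_at_dom.
Qed.

Lemma smooth_funP (f : M -> R) : smooth_fun f <-> forall p, msmooth p (f : M -> R^o).
Proof.
split=> [sf p|sf c ac].
  have /(smooth_onP _ (@image_open _ _ _ (chart_at p))) sc := sf _ (chart_at_atlas p).
  apply: sc.
  by exists p => //; exact: chart_at_dom.
apply/(smooth_onP _ (@image_open _ _ _ c)) => _ [p cp <-].
exact/(msmoothE _ ac cp)/sf.
Qed.

Lemma near_eq_tderive W p (F G : M -> W) v :
  (\forall q \near p, F q = G q) -> tderive F p v = tderive G p v.
Proof.
move=> FG; apply: near_eq_derive; exact: near_icoord (chart_at_dom p) FG.
Qed.

Lemma tderive_linear W p (F : M -> W) a u v : msmooth p F ->
  tderive F p (a *: u + v) = a *: tderive F p u + tderive F p v.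
Proof. by move=> /smooth_near_differentiable; exact: derive_linear. Qed.

Lemma tderive_cst W p (a : W) v : tderive (cst a : M -> W) p v = 0.
Proof. exact: derive_cst. Qed.

Lemma tderive_rV k p (F : M -> 'rV[R]_k) v i : msmooth p F ->
  tderive F p v 0 i = tderive (fun q => F q 0 i : R^o) p v.
Proof. by move=> /smooth_near_differentiable; exact: derive_rV. Qed.

Lemma tderive_comp W k p (F : M -> 'rV[R]_k) (h : 'rV[R]_k -> W) v :
  msmooth p F -> differentiable h (F p) ->
  tderive (h \o F) p v = 'D_(tderive F p v) h (F p).
Proof.
move=> sF dh; have dp := chart_at_dom p.
have := @derive_comp_rV _ _ _ _ (F \o icoord (chart_at p)) h (coord (chart_at p) p) v.
by rewrite /= coordK//; apply=> //; exact: smooth_near_differentiable.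
Qed.

(** Change of chart for derivatives: [tderive (coord c) p v] is the component vector in [c] of the
    tangent vector [v], and the rest is the chain rule for [F = (F \o icoord c) \o coord c]. *)
Lemma tderiveE W c p (F : M -> W) v : atlas M c -> dom c p -> msmooth p F ->
  tderive F p v = 'D_(tderive (coord c) p v) (F \o icoord c) (coord c p).
Proof.
move=> ac cp sF; rewrite -tderive_comp; last 2 first.
- exact: msmooth_coord.
- by apply: smooth_near_differentiable; exact/(msmoothE _ ac cp).
apply: near_eq_tderive; apply: filterS (near_dom cp) => q cq.
by rewrite /= coordK.
Qed.

Lemma tderive_chart_at p v : tderive (coord (chart_at p)) p v = v.
Proof.
rewrite -[RHS](@derive_id _ _ (coord (chart_at p) p) v).
apply: near_eq_derive.
by apply: filterS (near_icoordK (chart_at_dom p)) => y [_ /= ->].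
Qed.

Lemma msmooth_tderive W p (F : M -> W) (X : vfield M) :
  msmooth p F -> msmooth p (components (chart_at p) X) ->
  msmooth p (fun q => tderive F q (X q)).
Proof.
have dp := chart_at_dom p; have ap := chart_at_atlas p.
set c := chart_at p; move=> sF sX.
(* The derivative at [q] is defined through [chart_at q], which varies with [q]; near [p] it is
   rewritten in the fixed chart [c]. *)
apply: (@eq_smooth_near _ _ _ _
  (fun y => 'D_((components c X \o icoord c) y) (F \o icoord c) y)).
  apply: filterS2 (near_icoordK dp) (near_icoord dp (near_msmooth sF)).
  move=> y [cy yE] sy /=.
  by rewrite (tderiveE _ ap cy sy) /components yE.
exact: smooth_near_derive_along.
Qed.

(** The raw values [X q] refer to [chart_at q], which may jump with [q]; smoothness only makes sense
    for the components in one fixed chart. *)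
Definition vsmooth p (X : vfield M) := msmooth p (components (chart_at p) X).

(** For the converse, the components in [chart_at p] are the derivative of the transition map along
    the components in [c]. *)
Lemma vsmoothE c p (X : vfield M) : atlas M c -> dom c p ->
  vsmooth p X <-> msmooth p (components c X).
Proof.
move=> ac cp; split=> [sX|sX].
  exact: msmooth_tderive (msmooth_coord ac cp) sX.
apply/msmoothE; [exact: chart_at_atlas|exact: chart_at_dom|].
have dp := chart_at_dom p; have ap := chart_at_atlas p.
set d := chart_at p.
apply: (@eq_smooth_near _ _ _ _
  ((fun y => 'D_((components c X \o icoord c) y) (coord d \o icoord c) y) \o
   (coord c \o icoord d))).
  have near_c := near_icoord dp (near_dom cp).
  have near_d := near_icoord dp (near_msmooth (msmooth_coord ap dp)).
  apply: filterS2 near_c near_d => y cy sy /=.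
  by rewrite (coordK cy) /components [RHS](tderiveE _ ac cy sy).
apply: smooth_near_comp; first exact: smooth_transition.
rewrite /comp (coordK dp); apply: smooth_near_derive_along; first exact/(msmoothE _ ac cp).
exact: smooth_transition.
Qed.

Lemma smooth_vfieldP (X : vfield M) : smooth_vfield X <-> forall p, vsmooth p X.
Proof.
split=> [sf p|sf c ac].
  have /(smooth_onP _ (@image_open _ _ _ (chart_at p))) sc := sf _ (chart_at_atlas p).
  apply: sc.
  by exists p => //; exact: chart_at_dom.
apply/(smooth_onP _ (@image_open _ _ _ c)) => _ [p cp <-].
have sX := (vsmoothE X ac cp).1 (sf p).
exact: ((msmoothE _ ac cp).1 sX).
Qed.

Local Opaque smooth_fun smooth_vfield.

Lemma eq_vsmooth p (X Y : vfield M) :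
  (\forall q \near p, X q = Y q) -> vsmooth p X -> vsmooth p Y.
Proof.
by move=> XY; apply: eq_msmooth; apply: filterS XY => q; rewrite /components => ->.
Qed.

Lemma vsmooth_linear p (f : M -> R^o) (X Y : vfield M) :
  msmooth p f -> vsmooth p X -> vsmooth p Y -> vsmooth p (fun q => f q *: X q + Y q).
Proof.
move=> sf sX sY; have dp := chart_at_dom p; have ap := chart_at_atlas p.
apply: eq_msmooth (msmoothD (msmoothZ sf sX) sY).
apply: filterS (near_msmooth (msmooth_coord ap dp)) => q sq.
by rewrite /components tderive_linear.
Qed.

Lemma vsmooth0 p : vsmooth p (0 : vfield M).
Proof.
apply: eq_msmooth (msmooth_cst p (0 : 'rV[R]_n)).
by near=> q; rewrite /components [RHS]derive0.
Unshelve. all: by end_near. Qed.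

Lemma smooth_vfield0 : smooth_vfield (0 : vfield M).
Proof. by apply/smooth_vfieldP => p; exact: vsmooth0. Qed.

Lemma smooth_vfieldZD (f : M -> R) (X Y : vfield M) :
  smooth_fun f -> smooth_vfield X -> smooth_vfield Y ->
  smooth_vfield (fun q => f q *: X q + Y q).
Proof.
move=> /smooth_funP sf /smooth_vfieldP sX /smooth_vfieldP sY.
by apply/smooth_vfieldP => p; exact: vsmooth_linear.
Qed.

Lemma smooth_fun_cst (a : R) : smooth_fun (cst a : M -> R).
Proof. by apply/smooth_funP => p; exact: msmooth_cst. Qed.

Lemma smooth_vfieldD (X Y : vfield M) :
  smooth_vfield X -> smooth_vfield Y -> smooth_vfield (X + Y).
Proof.
move=> sX sY; have := smooth_vfieldZD (smooth_fun_cst 1) sX sY.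
by congr smooth_vfield; apply/funext => q; rewrite scale1r.
Qed.

Lemma smooth_vfieldZ (f : M -> R) (X : vfield M) :
  smooth_fun f -> smooth_vfield X -> smooth_vfield (fun q => f q *: X q).
Proof.
move=> sf sX; have := smooth_vfieldZD sf sX smooth_vfield0.
by congr smooth_vfield; apply/funext => q; rewrite addr0.
Qed.

Lemma smooth_vfieldN (X : vfield M) : smooth_vfield X -> smooth_vfield (- X).
Proof.
move=> sX; have := smooth_vfieldZ (smooth_fun_cst (- 1)) sX.
by congr smooth_vfield; apply/funext => q; rewrite scaleN1r.
Qed.

Lemma smooth_vfieldB (X Y : vfield M) :
  smooth_vfield X -> smooth_vfield Y -> smooth_vfield (X - Y).
Proof.
move=> sX sY.
have sNY := smooth_vfieldN sY.
exact: (smooth_vfieldD sX sNY).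
Qed.

Lemma smooth_vfield_sum (I : Type) (r : seq I) (X : I -> vfield M) :
  (forall i, smooth_vfield (X i)) -> smooth_vfield (\sum_(i <- r) X i).
Proof.
move=> sX; elim: r => [|i r IH]; first by rewrite big_nil; exact: smooth_vfield0.
by rewrite big_cons; exact: (smooth_vfieldD (sX i) IH).
Qed.

Lemma smooth_fderive (X : vfield M) (f : M -> R) :
  smooth_vfield X -> smooth_fun f -> smooth_fun (fderive X f).
Proof.
move=> /smooth_vfieldP sX /smooth_funP sf; apply/smooth_funP => p.
exact: msmooth_tderive (sf p) (sX p).
Qed.

(** Tangent vector at [p] with components [w] in the chart [c]. *)
Definition tvec c p (w : 'rV[R]_n) : 'rV[R]_n :=
  'D_w (coord (chart_at p) \o icoord c) (coord c p).

Lemma tvecK c p w : atlas M c -> dom c p -> tderive (coord c) p (tvec c p w) = w.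
Proof.
move=> ac cp; have dp := chart_at_dom p; have ap := chart_at_atlas p.
rewrite /tderive /tvec.
have -> : coord (chart_at p) p = (coord (chart_at p) \o icoord c) (coord c p).
  by rewrite /= coordK.
rewrite -derive_comp_rV; last 2 first.
- by apply: smooth_near_differentiable; exact: smooth_transition.
- rewrite /= coordK//; apply: smooth_near_differentiable; exact: smooth_transition.
rewrite -[RHS](@derive_id _ _ (coord c p) w); apply: near_eq_derive.
apply: filterS2 (near_icoordK cp) (near_icoord cp (near_dom dp)).
by move=> y [cy yE] dy; rewrite /= coordK.
Qed.

Lemma tderiveK c p v : atlas M c -> dom c p -> tvec c p (tderive (coord c) p v) = v.
Proof.
move=> ac cp; have dp := chart_at_dom p; have ap := chart_at_atlas p.
rewrite -[RHS](tderive_chart_at p) [RHS](tderiveE _ ac cp)//.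
exact: msmooth_coord.
Qed.

Lemma tvec_linear c p a u v : atlas M c -> dom c p ->
  tvec c p (a *: u + v) = a *: tvec c p u + tvec c p v.
Proof.
move=> ac cp; apply: derive_linear; apply: smooth_near_differentiable.
exact: smooth_transition (chart_at_atlas p) cp (chart_at_dom p).
Qed.

Lemma vsmooth_tvec c p w : atlas M c -> dom c p -> vsmooth p (fun q => tvec c q w).
Proof.
move=> ac cp; apply/(vsmoothE _ ac cp); apply: eq_msmooth (msmooth_cst p w).
by apply: filterS (near_dom cp) => q cq; rewrite /components tvecK.
Qed.

Lemma components_chart_at p (X : vfield M) : components (chart_at p) X p = X p.
Proof. exact: tderive_chart_at. Qed.

End Charts.

Local Opaque smooth_fun smooth_vfield derive.

(** * Global frames and tensoriality *)

Lemma linear_row_sum (R : pzRingType) n (W : lmodType R) (f : 'rV[R]_n -> W) v :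
  linear f -> f v = \sum_i v 0 i *: f (delta_mx 0 i).
Proof.
move=> fl; pose fM := GRing.isLinear.Build _ _ _ _ _ fl.
pose fL : {linear _ -> _} := HB.pack f fM.
rewrite -[LHS]/(fL v) {1}(row_sum_delta v) linear_sum.
by apply: eq_bigr => i _; rewrite linearZ.
Qed.

Section Cutoff.
Variables (R : realType) (n : nat) (M : manifold R n).

(** A bump function in the chart is extended by zero. The image in [M] of its compact set is closed
    because [M] is Hausdorff, so the extension vanishes near every point outside the chart domain
    and is smooth there. *)
Lemma cutoff (p : M) : exists (b : M -> R) (K : set M),
  [/\ smooth_fun b, b p = 1, closed K, K `<=` dom (chart_at p) &
      forall q, ~ K q -> b q = 0].
Proof.
have ap := chart_at_atlas p; have dp := chart_at_dom p; set c := chart_at p in ap dp *.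
have [h [K [sh h1 cK KU h0]]] := smooth_bump (near_image dp).
have KK : K `<=` (fun y => dom c (icoord c y) /\ coord c (icoord c y) = y).
  by move=> y /KU[q cq <-]; rewrite coordK.
have cK' : closed (icoord c @` K).
  apply: compact_closed; first exact: space_hausdorff.
  apply: continuous_compact => //; apply: continuous_in_subspaceT => y.
  rewrite inE => /KK[dy yE].
  by have := icoord_continuous dy; rewrite yE.
pose b q := if `[< dom c q >] then h (coord c q) else 0.
have b0 q : ~ (icoord c @` K) q -> b q = 0.
  rewrite /b => Kq; case: asboolP => // cq; apply: h0 => Kq'; apply: Kq.
  by exists (coord c q) => //; rewrite coordK.
exists b, (icoord c @` K); split=> //.
- apply/smooth_funP => q; have [cq|ncq] := pselect (dom c q).
    apply: (@eq_msmooth _ _ _ _ _ (h \o coord c)).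
      by apply: filterS (near_dom cq) => r cr; rewrite /b asboolT.
    apply: msmooth_comp; first exact: msmooth_coord.
    by exists setT => //; split=> //; exact: openT.
  apply: eq_msmooth (msmooth_cst q (0 : R^o)).
  have : \forall r \near q, ~ (icoord c @` K) r.
    apply: open_nbhs_nbhs; split; first exact: closed_openC.
    by move=> [y /KK[+ _]] yq; rewrite yq.
  by apply: filterS => r /b0 ->.
- by rewrite /b asboolT.
- by move=> _ [y /KK[] ? _ <-].
Qed.

Lemma smooth_vfield_cutoff (c : chart R n M) (K : set M) (b : M -> R) (X : vfield M) :
  smooth_fun b -> closed K -> K `<=` dom c -> (forall q, ~ K q -> b q = 0) ->
  (forall q, dom c q -> vsmooth q X) -> smooth_vfield (fun q => b q *: X q).
Proof.
move=> /smooth_funP sb cK Kc b0 sX; apply/smooth_vfieldP => q.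
have [cq|ncq] := pselect (dom c q).
  have := vsmooth_linear (sb q) (sX q cq) (vsmooth0 q).
  by apply: eq_vsmooth; near=> r; rewrite addr0.
apply: eq_vsmooth (vsmooth0 q).
have : \forall r \near q, ~ K r.
  by apply: open_nbhs_nbhs; split; [exact: closed_openC|move/Kc].
by apply: filterS => r /b0 ->; rewrite scale0r.
Unshelve. all: by end_near. Qed.

Lemma smooth_fun_cutoff (c : chart R n M) (K : set M) (b f : M -> R) :
  smooth_fun b -> closed K -> K `<=` dom c -> (forall q, ~ K q -> b q = 0) ->
  (forall q, dom c q -> msmooth q (f : M -> R^o)) -> smooth_fun (fun q => b q * f q).
Proof.
move=> /smooth_funP sb cK Kc b0 sf; apply/smooth_funP => q.
have [cq|ncq] := pselect (dom c q); first by apply: msmoothM; [exact: sb|exact: sf].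
apply: eq_msmooth (msmooth_cst q (0 : R^o)).
have : \forall r \near q, ~ K r.
  by apply: open_nbhs_nbhs; split; [exact: closed_openC|move/Kc].
by apply: filterS => r /b0 ->; rewrite mul0r.
Qed.

(** The frame is global but degenerates where the cutoff [b] vanishes. *)
Lemma global_frame (p : M) : exists (b : M -> R) (E : 'I_n -> vfield M),
  [/\ smooth_fun b /\ b p = 1, forall i, smooth_vfield (E i),
      forall i, E i p = delta_mx 0 i,
      forall q v, (b q * b q) *: v =
        \sum_i (b q * tderive (coord (chart_at p)) q v 0 i) *: E i q &
      forall Z i, smooth_vfield Z ->
        smooth_fun (fun q => b q * components (chart_at p) Z q 0 i)].
Proof.
have [b [K [sb b1 cK Kc b0]]] := cutoff p.
have ap := chart_at_atlas p; have dp := chart_at_dom p; set c := chart_at p in ap dp Kc *.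
exists b, (fun i q => b q *: tvec c q (delta_mx 0 i)); split=> //.
- move=> i; apply: (smooth_vfield_cutoff sb cK Kc b0) => q cq.
  exact: vsmooth_tvec.
- by move=> i; rewrite b1 scale1r -[LHS](tderive_chart_at p) tvecK.
- move=> q v; have [cq|ncq] := pselect (dom c q); last first.
    by rewrite b0 => [|/Kc//]; rewrite mul0r scale0r big1// => i _; rewrite mul0r scale0r.
  rewrite -{1}(tderiveK v ap cq).
  rewrite (linear_row_sum _ (fun a u w => tvec_linear a u w ap cq)).
  rewrite scaler_sumr; apply: eq_bigr => i _.
  by rewrite !scalerA; congr (_ *: _); ring.
- move=> Z i /smooth_vfieldP sZ.
  apply: (smooth_fun_cutoff sb cK Kc b0) => q cq.
  have /(vsmoothE _ ap cq)/msmooth_rV := sZ q; exact.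
Qed.

Lemma exists_extension (p : M) v : exists X : vfield M, smooth_vfield X /\ X p = v.
Proof.
have [b [E [[sb b1] sE E1 _ _]]] := global_frame p.
exists (\sum_i (fun q => v 0 i *: E i q)); split.
  apply: smooth_vfield_sum => i.
  exact: smooth_vfieldZ (smooth_fun_cst (v 0 i)) (sE i).
by rewrite fct_sumE [RHS]row_sum_delta; apply: eq_bigr => i _; rewrite E1.
Qed.

(** The default value of [xget] is never taken, since an extension exists. *)
Lemma extendP (p : M) v : smooth_vfield (extend p v) /\ extend p v p = v.
Proof.
have [X HX] := exists_extension p v.
exact: (@xgetPex _ 0 [set X | _] (ex_intro _ X HX)).
Qed.

Lemma smooth_funD (f h : M -> R) :
  smooth_fun f -> smooth_fun h -> smooth_fun (fun q => f q + h q).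
Proof.
by move=> /smooth_funP sf /smooth_funP sh; apply/smooth_funP => q; exact: msmoothD.
Qed.

Lemma smooth_funM (f h : M -> R) :
  smooth_fun f -> smooth_fun h -> smooth_fun (fun q => f q * h q).
Proof.
by move=> /smooth_funP sf /smooth_funP sh; apply/smooth_funP => q; exact: msmoothM.
Qed.

Section Tensorial.
Variables (p : M) (W : lmodType R) (T : vfield M -> W).
Hypothesis TD : forall X Y, smooth_vfield X -> smooth_vfield Y -> T (X + Y) = T X + T Y.
Hypothesis TZ : forall f X, smooth_fun f -> smooth_vfield X ->
  T (fun q => f q *: X q) = f p *: T X.

Lemma tensorial_sum (I : Type) (r : seq I) (X : I -> vfield M) :
  (forall i, smooth_vfield (X i)) -> T (\sum_(i <- r) X i) = \sum_(i <- r) T (X i).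
Proof.
move=> sX; elim: r => [|i r IH]; last first.
  by rewrite !big_cons TD ?IH//; exact: smooth_vfield_sum.
rewrite !big_nil.
have := TZ (smooth_fun_cst (M := M) 0) (smooth_vfield0 (M := M)); rewrite scale0r => <-.
by congr T; apply/funext => q; rewrite scale0r.
Qed.

(** [X] is a combination of global smooth fields whose coefficients are global smooth functions
    vanishing at [p]. *)
Lemma tensorial0 X : smooth_vfield X -> X p = 0 -> T X = 0.
Proof.
move=> sX X0; have [b [E [[sb b1] sE E1 zE sz]]] := global_frame p.
have sb2 : smooth_fun (fun q => b q * b q) by exact: smooth_funM.
have sb3 : smooth_fun (fun q => 1 + - 1 * (b q * b q)).
  by apply: smooth_funD; [|apply: smooth_funM => //]; exact: smooth_fun_cst.
pose z i q := b q * components (chart_at p) X q 0 i.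
(* The frame only recovers [b^2 X]; the remainder [(1 - b^2) X] has a coefficient vanishing at [p]
   because [b p = 1]. *)
have -> : X = (fun q => (1 + - 1 * (b q * b q)) *: X q) +
    \sum_i (fun q => z i q *: E i q).
  apply/funext => q; rewrite [RHS]/GRing.add/= fct_sumE -zE -scalerDl.
  by rewrite mulN1r subrK scale1r.
have sS i : smooth_vfield (fun q => z i q *: E i q).
  by apply: smooth_vfieldZ (sE i); exact: sz.
rewrite TD; [|exact: smooth_vfieldZ|exact: smooth_vfield_sum].
rewrite TZ// b1 !mulr1 subrr scale0r add0r tensorial_sum//.
rewrite big1 // => i _; rewrite (TZ (sz X i sX) (sE i)).
by rewrite /z components_chart_at X0 mxE mulr0 scale0r.
Qed.

Lemma tensorial_eq X Y : smooth_vfield X -> smooth_vfield Y -> X p = Y p -> T X = T Y.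
Proof.
move=> sX sY XY; have sNY := smooth_vfieldN sY.
have E : T (X - Y) = 0.
  by apply: tensorial0; [exact: smooth_vfieldB|rewrite /GRing.add/= /GRing.opp/= XY subrr].
by have := TD sY (smooth_vfieldB sX sY); rewrite E addr0 addrC subrK.
Qed.

(** The chosen extensions need not depend linearly on the vector; only their values at [p] do, and
    [T] sees nothing else. *)
Lemma tensorial_extend a u v :
  T (extend p (a *: u + v)) = a *: T (extend p u) + T (extend p v).
Proof.
have [su eu] := extendP p u; have [sv ev] := extendP p v.
have [sw ew] := extendP p (a *: u + v).
have sa := smooth_fun_cst (M := M) a.
have sau := smooth_vfieldZ sa su.
rewrite -(TZ sa su) -(TD sau sv).
apply: (tensorial_eq sw (smooth_vfieldD sau sv)).
by rewrite ew /GRing.add/= eu ev.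
Qed.

End Tensorial.

End Cutoff.

Section Bracket.
Variables (R : realType) (n : nat).

(** * Brackets, metrics and connections *)

Lemma sub_cancel_common (V : zmodType) (a b t1 t2 s1 s2 r : V) :
  a = t1 + s1 -> b = t2 + s2 -> s1 = s2 -> r = t1 - t2 -> r = a - b.
Proof. by move=> -> -> -> ->; rewrite opprD addrACA subrr addr0. Qed.

Lemma subrDD (V : zmodType) (a a' b b' c c' : V) :
  (a + a') - (b + b') - (c + c') = (a - b - c) + (a' - b' - c').
Proof. by rewrite !opprD (addrACA a a') (addrACA (a - b)). Qed.

(** Leibniz rule on the sum of the [Y^i d_i G], with Schwarz to exchange [d_i] and ['D_u]. *)
Lemma derive_derive_along (x u : 'rV[R]_n) (Y : 'rV[R]_n -> 'rV[R]_n)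
    (G : 'rV[R]_n -> R^o) :
  smooth_near x Y -> smooth_near x G ->
  'D_u (fun y => 'D_(Y y) G y) x = 'D_('D_u Y x) G x + 'D_(Y x) ('D_u G) x.
Proof.
move=> sY sG.
have dY := smooth_near_differentiable sY.
have dYi i := differentiable_rV_comp i dY.
have dGi i := smooth_near_differentiable (smooth_near_derive (delta_mx 0 i : 'rV[R]_n) sG).
have dGu := smooth_near_differentiable (smooth_near_derive u sG).
transitivity ('D_u (\sum_i (fun y => Y y 0 i *: 'D_(delta_mx 0 i) G y)) x).
  apply: near_eq_derive; apply: filterS (smooth_near_near sG) => y sy.
  by rewrite fct_sumE; apply: derive_sum_delta; exact: smooth_near_differentiable.
rewrite derive_sum; last first.
  by move=> i; apply: diff_derivable; have [] := differentiable_scale (dYi i) (dGi i).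
rewrite (derive_sum_delta _ (smooth_near_differentiable sG)).
rewrite (derive_sum_delta _ dGu) -big_split/=; apply: eq_bigr => i _.
have [_ ->] := differentiable_scale (dYi i) (dGi i).
have e1 := esym (derive_rV u i dY).
have e2 := smooth_near_deriveC u (delta_mx 0 i) sG.
move: e1 e2.
set A := 'D_u (fun y => Y y 0 i) x.
set B := 'D_u ('D_(delta_mx 0 i) G) x.
move=> -> ->.
by rewrite addrC.
Qed.

Variable M : manifold R n.

(** The bracket is the commutator of derivations: each iterated derivative is a first-order term
    plus a Hessian term, and the Hessian terms cancel by Schwarz. *)
Lemma tderive_bracket (F : M -> R^o) (X Y : vfield M) p :
  msmooth p F -> vsmooth p X -> vsmooth p Y ->
  tderive F p (bracket X Y p) =
  tderive (fun q => tderive F q (Y q) : R^o) p (X p) -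
  tderive (fun q => tderive F q (X q) : R^o) p (Y p).
Proof.
move=> sF sX sY; have dp := chart_at_dom p; have ap := chart_at_atlas p.
have E (A B : vfield M) : vsmooth p A -> vsmooth p B ->
    tderive (fun q => tderive F q (B q) : R^o) p (A p) =
    tderive F p (tderive (components (chart_at p) B) p (A p)) +
    'D_(B p) ('D_(A p) (F \o icoord (chart_at p))) (coord (chart_at p) p).
  move=> sA sB.
  have BE : (components (chart_at p) B \o icoord (chart_at p)) (coord (chart_at p) p) = B p.
    by rewrite /comp coordK//; exact: components_chart_at.
  have := derive_derive_along (A p) sB sF; rewrite BE; apply: etrans.
  apply: near_eq_derive.
  apply: filterS2 (near_icoordK dp) (near_icoord dp (near_msmooth sF)).
  by move=> y [cy yE] sy; rewrite /comp (tderiveE _ ap cy sy) /components yE.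
apply: (sub_cancel_common (E X Y sX sY) (E Y X sY sX)).
  exact: smooth_near_deriveC (Y p) (X p) sF.
rewrite /bracket addrC -scaleN1r (tderive_linear _ _ _ sF) scaleN1r.
exact: addrC.
Qed.

End Bracket.

(** * Nondegeneracy of the metric *)

Section Metric.
Variables (R : realType) (n : nat) (M : manifold R n) (g : metric M).

Lemma innerC p u v : inner g p u v = inner g p v u.
Proof.
rewrite /inner /form_at.
have -> : u *m gram g p *m v^T = (v *m gram g p *m u^T)^T.
  by rewrite !trmx_mul trmxK gram_sym mulmxA.
by rewrite mxE.
Qed.

Lemma inner0l p w : inner g p 0 w = 0.
Proof. by rewrite /inner /form_at !mul0mx mxE. Qed.

Lemma innerDl p u v w : inner g p (u + v) w = inner g p u w + inner g p v w.
Proof. by rewrite /inner /form_at !mulmxDl mxE. Qed.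

Lemma innerZl p a u w : inner g p (a *: u) w = a * inner g p u w.
Proof. by rewrite /inner /form_at -!scalemxAl mxE. Qed.

Lemma innerNl p u w : inner g p (- u) w = - inner g p u w.
Proof. by rewrite -scaleN1r innerZl mulN1r. Qed.

Lemma innerBl p u v w : inner g p (u - v) w = inner g p u w - inner g p v w.
Proof. by rewrite innerDl innerNl. Qed.

Lemma inner0r p w : inner g p w 0 = 0.
Proof. by rewrite innerC inner0l. Qed.

Lemma innerDr p u v w : inner g p w (u + v) = inner g p w u + inner g p w v.
Proof. by rewrite innerC innerDl !(innerC p w). Qed.

Lemma inner_suml p (I : Type) (r : seq I) (u : I -> 'rV[R]_n) w :
  inner g p (\sum_(i <- r) u i) w = \sum_(i <- r) inner g p (u i) w.
Proof.
elim: r => [|i r IH]; first by rewrite !big_nil inner0l.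
by rewrite !big_cons innerDl IH.
Qed.

Lemma inner_eq0 p u : inner g p u u = 0 -> u = 0.
Proof.
by move=> u0; apply: contra_eq u0 => un; rewrite gt_eqF//; exact: gram_pos.
Qed.

Lemma inner_inj p u v : (forall w, inner g p u w = inner g p v w) -> u = v.
Proof.
move=> uv; apply/eqP; rewrite -subr_eq0; apply/eqP/(@inner_eq0 p).
by rewrite innerBl uv subrr.
Qed.

(** A row in the kernel of the Gram matrix is a vector of square norm zero. *)
Lemma gram_unitmx p : gram g p \in unitmx.
Proof.
rewrite -row_free_unit -kermx_eq0; apply/eqP/row_matrixP => i; rewrite row0.
apply: (@inner_eq0 p).
by rewrite /inner /form_at -row_mul mulmx_ker row0 mul0mx mxE.
Qed.

(** Lowering an index is invertible with smooth inverse. *)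
Lemma smooth_vfield_inner (X : vfield M) :
  (forall Z, smooth_vfield Z -> smooth_fun (innerf g X Z)) -> smooth_vfield X.
Proof.
move=> sX; apply/smooth_vfieldP => p.
have [b [E [[sb b1] sE E1 zE _]]] := global_frame p.
pose xi q : 'rV[R]_n := \row_j innerf g X (E j) q.
pose Gm q : 'M[R]_n := \matrix_(i, j) innerf g (E i) (E j) q.
have Gp : Gm p = gram g p.
  apply/matrixP => i j; rewrite mxE /innerf !E1 /inner /form_at.
  by rewrite -rowE trmx_delta -colE !mxE.
have sG i j : msmooth p (fun q => Gm q i j : R^o).
  rewrite (_ : (fun q => _) = innerf g (E i) (E j)); last first.
    by apply/funext => q; rewrite mxE.
  by move/smooth_funP : (gram_smooth g (sE i) (sE j)); exact.
have sxi j : msmooth p (fun q => xi q 0 j : R^o).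
  rewrite (_ : (fun q => _) = innerf g X (E j)); last first.
    by apply/funext => q; rewrite mxE.
  by move/smooth_funP : (sX (E j) (sE j)); exact.
have Gu : Gm p \in unitmx by rewrite Gp gram_unitmx.
pose a q := xi q *m invmx (Gm q).
have sa i : msmooth p (fun q => a q 0 i : R^o).
  rewrite (_ : (fun q => _) = (fun q => \sum_j xi q 0 j * invmx (Gm q) j i)); last first.
    by apply/funext => q; rewrite mxE.
  apply: msmooth_sum => j _; apply: msmoothM => //.
  exact: msmooth_invmx.
have near_b : \forall q \near p, b q != 0.
  move/smooth_funP/(_ p)/msmooth_continuous : sb => cb.
  by apply: (cvgr_neq0 (V := R^o) (b p) cb); rewrite b1 oner_neq0.
have near_G : \forall q \near p, Gm q \in unitmx.
  have sd : msmooth p (fun q => \det (Gm q) : R^o).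
    exact: (smooth_near_det (A := Gm \o icoord (chart_at p))).
  have dp : \det (Gm p) != 0 by rewrite -unitfE -unitmxE.
  apply: filterS (cvgr_neq0 (V := R^o) _ (msmooth_continuous sd) dp) => q.
  by rewrite unitmxE unitfE.
apply: (@eq_vsmooth _ _ _ _ (fun q => \sum_i a q 0 i *: E i q)).
  apply: filterS2 near_b near_G => q bq Gq.
  (* Frame components of [X q]; pairing with each [E j] gives [xi q = w *m Gm q], so the row [a q],
     smooth by construction, computes them. *)
  pose w : 'rV[R]_n := \row_i ((b q * b q)^-1 *
    (b q * tderive (coord (chart_at p)) q (X q) 0 i)).
  have Xw : X q = \sum_i w 0 i *: E i q.
    transitivity ((b q * b q)^-1 *: ((b q * b q) *: X q)).
      by rewrite scalerA mulVf ?scale1r// mulf_neq0.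
    by rewrite zE scaler_sumr; apply: eq_bigr => i _; rewrite scalerA mxE.
  suff -> : a q = w by [].
  rewrite /a; have -> : xi q = w *m Gm q; last by rewrite mulmxK.
  apply/rowP => j; rewrite mxE {1}/innerf Xw inner_suml mxE; apply: eq_bigr => i _.
  by rewrite innerZl [Gm q i j]mxE.
have : forall r : seq 'I_n, vsmooth p (fun q => \sum_(i <- r) a q 0 i *: E i q).
  elim=> [|i r IH].
    by apply: eq_vsmooth (vsmooth0 p); near=> q; rewrite big_nil.
  have /smooth_vfieldP/(_ p) sEi := sE i.
  by apply: eq_vsmooth (vsmooth_linear (sa i) sEi IH); near=> q; rewrite big_cons.
exact.
Unshelve. all: by end_near. Qed.

End Metric.

(** * Tensoriality of connections and curvature *)

Section Connection.
Variables (R : realType) (n : nat) (M : manifold R n) (nabla : connection M).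
Implicit Types X Y Z : vfield M.

Lemma covd_tensorial X X' Y p : smooth_vfield X -> smooth_vfield X' ->
  smooth_vfield Y -> X p = X' p -> nabla X Y p = nabla X' Y p.
Proof.
move=> sX sX' sY; apply: (tensorial_eq (T := fun X => nabla X Y p)) => //.
- by move=> A B sA sB; rewrite covdDl.
- by move=> f A sf sA; rewrite covdMl.
Qed.

Lemma covd_extend_linear Y p : smooth_vfield Y ->
  linear (fun z => nabla (extend p z) Y p).
Proof.
move=> sY a u v; apply: (tensorial_extend (T := fun X => nabla X Y p)).
- by move=> A B sA sB; rewrite covdDl.
- by move=> f A sf sA; rewrite covdMl.
Qed.

Lemma covd0l Y : smooth_vfield Y -> nabla 0 Y = 0.
Proof.
move=> sY; have s0 := smooth_vfield0 (M := M).
have := covdDl nabla s0 s0 sY; rewrite addr0 => E.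
by apply: (addrI (nabla 0 Y)); rewrite addr0.
Qed.

Lemma covd0r X : smooth_vfield X -> nabla X 0 = 0.
Proof.
move=> sX; have s0 := smooth_vfield0 (M := M).
have := covdDr nabla sX s0 s0; rewrite addr0 => E.
by apply: (addrI (nabla X 0)); rewrite addr0.
Qed.

Lemma covdNl X Y : smooth_vfield X -> smooth_vfield Y -> nabla (- X) Y = - nabla X Y.
Proof.
move=> sX sY; apply: (addrI (nabla X Y)).
have sN := smooth_vfieldN sX.
by rewrite -(covdDl nabla sX sN sY) !subrr covd0l.
Qed.

Lemma covdBl X X' Y : smooth_vfield X -> smooth_vfield X' -> smooth_vfield Y ->
  nabla (X - X') Y = nabla X Y - nabla X' Y.
Proof.
move=> sX sX' sY; have sN := smooth_vfieldN sX'.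
by rewrite (covdDl nabla sX sN sY) (covdNl sX' sY).
Qed.

Hypothesis torsion0 : torsion_free nabla.

Lemma smooth_bracket X Y : smooth_vfield X -> smooth_vfield Y ->
  smooth_vfield (bracket X Y).
Proof.
move=> sX sY; rewrite -(torsion0 sX sY).
by apply: smooth_vfieldB; exact: covd_smooth.
Qed.

Lemma curvatureDl X X' Y Z : smooth_vfield X -> smooth_vfield X' ->
  smooth_vfield Y -> smooth_vfield Z ->
  curvature nabla (X + X') Y Z = curvature nabla X Y Z + curvature nabla X' Y Z.
Proof.
move=> sX sX' sY sZ; have sXX := smooth_vfieldD sX sX'.
have sYZ := covd_smooth nabla sY sZ.
have s1 := covd_smooth nabla sX sZ; have s2 := covd_smooth nabla sX' sZ.
have b1 := smooth_bracket sX sY; have b2 := smooth_bracket sX' sY.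
have bE : bracket (X + X') Y = bracket X Y + bracket X' Y.
  rewrite -(torsion0 sXX sY) -(torsion0 sX sY) -(torsion0 sX' sY).
  by rewrite (covdDl nabla sX sX' sY) (covdDr nabla sY sX sX') opprD addrACA.
rewrite /curvature bE (covdDl nabla sX sX' sYZ) (covdDl nabla sX sX' sZ).
rewrite (covdDr nabla sY s1 s2) (covdDl nabla b1 b2 sZ).
exact: subrDD.
Qed.

(** The term [Y(f) nabla_X Z] arises from [nabla_Y (f nabla_X Z)] and, with the opposite sign, from
    [[f X, Y] = f [X, Y] - Y(f) X]. *)
Lemma curvatureMl f X Y Z p : smooth_fun f -> smooth_vfield X ->
  smooth_vfield Y -> smooth_vfield Z ->
  curvature nabla (fun q => f q *: X q) Y Z p = f p *: curvature nabla X Y Z p.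
Proof.
move=> sf sX sY sZ; have sfX := smooth_vfieldZ sf sX.
have sYZ := covd_smooth nabla sY sZ; have sXZ := covd_smooth nabla sX sZ.
have sXY := smooth_bracket sX sY; have sYf := smooth_fderive sY sf.
(* Torsion-freeness turns brackets into covariant derivatives, whose Leibniz rules are axioms. *)
have bE : bracket (fun q => f q *: X q) Y =
    (fun q => f q *: bracket X Y q) - (fun q => fderive Y f q *: X q).
  rewrite -(torsion0 sfX sY) -(torsion0 sX sY).
  rewrite (covdMl nabla sf sX sY) (covdMr nabla sf sY sX).
  apply/funext => q; rewrite /GRing.add/= /GRing.opp/=.
  by rewrite opprD addrCA scalerDr scalerN addrC -addrA.
have s1 := smooth_vfieldZ sf sXY; have s2 := smooth_vfieldZ sYf sX.
rewrite /curvature bE (covdBl s1 s2 sZ) (covdMl nabla sf sXY sZ).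
rewrite (covdMl nabla sYf sX sZ) (covdMl nabla sf sX sYZ) (covdMl nabla sf sX sZ).
rewrite (covdMr nabla sf sY sXZ) /GRing.add/= /GRing.opp/=.
rewrite !scalerDr !scalerN !opprD opprK.
rewrite -!addrA; congr (_ + _); rewrite addrCA; congr (_ + _).
by rewrite addrCA addNr addr0.
Qed.

Lemma curvature_tensorial X X' Y Z p : smooth_vfield X -> smooth_vfield X' ->
  smooth_vfield Y -> smooth_vfield Z -> X p = X' p ->
  curvature nabla X Y Z p = curvature nabla X' Y Z p.
Proof.
move=> sX sX' sY sZ; apply: (tensorial_eq (T := fun X => curvature nabla X Y Z p)) => //.
- by move=> A B sA sB; rewrite curvatureDl.
- by move=> f A sf sA; exact: curvatureMl.
Qed.

Lemma curvature_extend_linear Y Z p : smooth_vfield Y -> smooth_vfield Z ->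
  linear (fun z => curvature nabla (extend p z) Y Z p).
Proof.
move=> sY sZ a u v.
apply: (tensorial_extend (T := fun X => curvature nabla X Y Z p)).
- by move=> A B sA sB; rewrite curvatureDl.
- by move=> f A sf sA; exact: curvatureMl.
Qed.

End Connection.

(** * Submersions *)

Lemma mul_rV_lin1_linear (R : comNzRingType) m n (f : 'rV[R]_m -> 'rV[R]_n) v :
  linear f -> v *m lin1_mx f = f v.
Proof.
move=> fl; pose fM := GRing.isLinear.Build _ _ _ _ _ fl.
pose fL : {linear _ -> _} := HB.pack f fM.
exact: (mul_rV_lin1 fL).
Qed.

Lemma subr0_eq0 (V : zmodType) (a b : V) : a = 0 -> b = 0 -> a - b = 0.
Proof. by move=> -> ->; rewrite subrr. Qed.

Section SmoothMap.
Variables (R : realType) (m n : nat) (M : manifold R m) (N : manifold R n).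
Variables (psi : M -> N).
Hypothesis spsi : smooth_map psi.

Lemma near_psi p (A : set N) : nbhs (psi p) A -> \forall q \near p, A (psi q).
Proof. by move=> pA; have [cpsi _] := spsi; exact: cpsi. Qed.

Lemma msmooth_coord_psi d p : atlas N d -> dom d (psi p) ->
  msmooth p (coord d \o psi).
Proof.
move=> ad dp; have [cpsi H] := spsi.
have := H _ _ (chart_at_atlas p) ad.
exists (coord (chart_at p) @` (dom (chart_at p) `&` psi @^-1` dom d)) => //.
split.
  apply: open_coord_image; apply: open_comp; last exact: dom_open.
  by move=> x _; exact: cpsi.
by exists p => //; split=> //; exact: chart_at_dom.
Qed.

(** Factoring [f \o psi] through a chart of [N] reduces it to a map from [M] to a row space followed
    by a map between normed spaces. *)
Lemma near_psi_icoord W p (f : N -> W) : \forall q \near p,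
  ((f \o icoord (chart_at (psi p))) \o (coord (chart_at (psi p)) \o psi)) q = f (psi q).
Proof.
apply: filterS (near_psi (near_dom (chart_at_dom (psi p)))) => q dq.
by rewrite /comp coordK.
Qed.

Lemma msmooth_comp_psi (W : normedModType R) p (f : N -> W) :
  msmooth (psi p) f -> msmooth p (f \o psi).
Proof.
move=> sf; apply: eq_msmooth (near_psi_icoord p f) _.
apply: msmooth_comp => //.
exact: msmooth_coord_psi (chart_at_atlas _) (chart_at_dom _).
Qed.

Lemma tderive_comp_psi (W : normedModType R) p (f : N -> W) v :
  msmooth (psi p) f -> tderive (f \o psi) p v = tderive f (psi p) (tmap psi p v).
Proof.
move=> sf; rewrite -(near_eq_tderive v (near_psi_icoord p f)).
apply: tderive_comp; first exact: msmooth_coord_psi (chart_at_atlas _) (chart_at_dom _).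
exact: smooth_near_differentiable.
Qed.

Lemma tmap_linear p : linear (tmap psi p).
Proof.
move=> a u v; apply: tderive_linear.
exact: msmooth_coord_psi (chart_at_atlas _) (chart_at_dom _).
Qed.

Lemma tmapB p u v : tmap psi p (u - v) = tmap psi p u - tmap psi p v.
Proof. by rewrite addrC -scaleN1r tmap_linear scaleN1r addrC. Qed.

(** Smoothness near [p0] of a vector field along [psi], given by
    [w p \in T_(psi p) N]. *)
Definition smooth_along p0 (w : M -> 'rV[R]_n) : Prop :=
  msmooth p0 (fun p => tderive (coord (chart_at (psi p0))) (psi p) (w p)).

Lemma smooth_along_comp p0 (X' : vfield N) :
  smooth_vfield X' -> smooth_along p0 (X' \o psi).
Proof. by move=> /smooth_vfieldP sX'; exact: (msmooth_comp_psi (sX' (psi p0))). Qed.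

Lemma smooth_along_tmap p0 (Z : vfield M) :
  smooth_vfield Z -> smooth_along p0 (fun p => tmap psi p (Z p)).
Proof.
move=> /smooth_vfieldP sZ; have ad := chart_at_atlas (psi p0).
have dd := chart_at_dom (psi p0).
apply: eq_msmooth (msmooth_tderive (msmooth_coord_psi ad dd) (sZ p0)).
apply: filterS (near_psi (near_dom dd)) => q dq.
by rewrite tderive_comp_psi//; exact: msmooth_coord.
Qed.

(** Both fields are expanded in a frame of [N] pulled back by [psi]; the inner product becomes a sum
    of smooth coefficients times [g'(E_i, E_j) \o psi]. *)
Lemma msmooth_inner_along (g' : metric N) p0 w1 w2 :
  smooth_along p0 w1 -> smooth_along p0 w2 ->
  msmooth p0 (fun p => inner g' (psi p) (w1 p) (w2 p) : R^o).
Proof.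
move=> /msmooth_rV s1 /msmooth_rV s2; pose d := chart_at (psi p0).
have [b [E [[sb b1] sE _ zE _]]] := global_frame (psi p0).
have near_b : \forall q \near p0, b (psi q) != 0.
  suff nb : \forall y \near psi p0, b y != 0 by exact: near_psi nb.
  move/smooth_funP/(_ (psi p0))/msmooth_continuous : sb => cb.
  by apply: (cvgr_neq0 (V := R^o) _ cb); rewrite b1 oner_neq0.
(* The frame identity [b^2 w = sum_i (b w^i) E_i] divided by [b^2], which is nonzero near
   [psi p0]. *)
pose a (w : M -> 'rV[R]_n) i p : R^o := (b (psi p))^-1 * tderive (coord d) (psi p) (w p) 0 i.
have sa w i : (forall i, msmooth p0 (fun q => tderive (coord d) (psi q) (w q) 0 i : R^o)) ->
    msmooth p0 (a w i).
  move=> sw; apply: (msmoothM _ (sw i)); apply: msmoothV; first by rewrite b1 oner_neq0.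
  by apply: (@msmooth_comp_psi R^o p0 b); move/smooth_funP : sb; exact.
have wE w p : b (psi p) != 0 -> w p = \sum_i a w i p *: E i (psi p).
  move=> bp.
  transitivity ((b (psi p) * b (psi p))^-1 *: ((b (psi p) * b (psi p)) *: w p)).
    by rewrite scalerA mulVf ?scale1r// mulf_neq0.
  rewrite zE scaler_sumr; apply: eq_bigr => i _; rewrite scalerA /a; congr (_ *: _).
  by rewrite invfM -mulrA (mulKf bp).
apply: (@eq_msmooth _ _ _ _ _
  (fun p => \sum_i \sum_j a w1 i p * (a w2 j p * innerf g' (E i) (E j) (psi p)) : R^o)).
  apply: filterS near_b => p bp; rewrite (wE w1 p bp) (wE w2 p bp) inner_suml.
  apply: eq_bigr => i _; rewrite innerZl [in RHS]innerC inner_suml mulr_sumr.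
  by apply: eq_bigr => j _; rewrite innerZl [in RHS]innerC.
apply: msmooth_sum => i _; apply: msmooth_sum => j _.
apply: (msmoothM (sa w1 i s1)); apply: (msmoothM (sa w2 j s2)).
apply: (@msmooth_comp_psi R^o p0 (innerf g' (E i) (E j))).
by move/smooth_funP : (gram_smooth g' (sE i) (sE j)); exact.
Qed.

(** Tested on the coordinates [F] of [psi]: [U F] vanishes, and [X F] is the pullback of a function
    of [N], so [U (X F)] vanishes too; hence [[U, X] F = 0]. *)
Lemma tmap_bracket_vertical (U X : vfield M) (X' : vfield N) p :
  smooth_vfield U -> smooth_vfield X -> smooth_vfield X' ->
  (forall q, vertical psi q (U q)) -> related psi X X' ->
  vertical psi p (bracket U X p).
Proof.
move=> /smooth_vfieldP sU /smooth_vfieldP sX /smooth_vfieldP sX' vU rX.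
have ad := chart_at_atlas (psi p); have dd := chart_at_dom (psi p).
have sF := msmooth_coord_psi ad dd.
rewrite /vertical /= /tmap; apply/rowP => i; rewrite mxE (tderive_rV _ _ sF).
pose F q : R^o := (coord (chart_at (psi p)) \o psi) q 0 i.
have sFi : msmooth p F by move/msmooth_rV : sF; apply.
rewrite -[LHS]/(tderive F p (bracket U X p)) (tderive_bracket sFi (sU p) (sX p)).
have FE q v : dom (chart_at (psi p)) (psi q) -> tderive F q v =
    tderive (coord (chart_at (psi p))) (psi q) (tmap psi q v) 0 i.
  move=> dq; rewrite -(tderive_rV _ _ (msmooth_coord_psi ad dq)).
  by rewrite tderive_comp_psi//; exact: msmooth_coord.
have nd := near_psi (near_dom dd).
have vanish : tderive (fun q => tderive F q (U q) : R^o) p (X p) = 0.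
  rewrite -[RHS](tderive_cst p (0 : R^o) (X p)); apply: near_eq_tderive.
  by apply: filterS nd => q dq; rewrite (FE _ _ dq) vU [tderive _ _ 0]derive0 mxE.
have basic : tderive (fun q => tderive F q (X q) : R^o) p (U p) = 0.
  pose h r : R^o := components (chart_at (psi p)) X' r 0 i.
  have sh : msmooth (psi p) h by move/msmooth_rV : (sX' (psi p)); apply.
  transitivity (tderive (h \o psi) p (U p)).
    by apply: near_eq_tderive; apply: filterS nd => q dq; rewrite (FE _ _ dq) rX.
  by rewrite (tderive_comp_psi _ sh) vU [LHS]derive0.
exact: (subr0_eq0 basic vanish).
Qed.

End SmoothMap.

(** * Horizontal lifts and traces *)

Section HorizontalLift.
Variables (R : realType) (m n : nat) (M : manifold R m) (N : manifold R n).
Variables (psi : M -> N) (g : metric M) (g' : metric N).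
Hypothesis Rpsi : riemannian_submersion psi g g'.

Let spsi : smooth_map psi. Proof. by case: Rpsi. Qed.

(** The adjoint of the differential with respect to [g] and [g'], which for a
    Riemannian submersion is the horizontal lift. *)
Definition hlift (p : M) (w : 'rV[R]_n) : 'rV[R]_m :=
  w *m (gram g' (psi p) *m (lin1_mx (tmap psi p))^T *m invmx (gram g p)).

Lemma hlift_adjoint p w z :
  inner g p (hlift p w) z = inner g' (psi p) w (tmap psi p z).
Proof.
rewrite /inner /form_at /hlift -(mul_rV_lin1_linear z (tmap_linear spsi p)).
by rewrite trmx_mul !mulmxA mulmxKV// gram_unitmx.
Qed.

Lemma horizontal_hlift p w : horizontal psi g p (hlift p w).
Proof. by move=> v vv; rewrite hlift_adjoint vv inner0r. Qed.

(** Let [C] be the differential after its adjoint. Surjectivity of the differential makes [C]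
    injective, hence invertible. The isometry gives [g'(C w, C y) = g(hlift w, hlift y) = g'(w, C
    y)] for all [y], so [C w = w]. *)
Lemma tmap_hlift p w : tmap psi p (hlift p w) = w.
Proof.
have [_ _ surj iso] := Rpsi.
have lt := tmap_linear spsi p.
pose C := gram g' (psi p) *m (lin1_mx (tmap psi p))^T *m invmx (gram g p) *m
  lin1_mx (tmap psi p).
have CE (w1 : 'rV[R]_n) : w1 *m C = tmap psi p (hlift p w1).
  by rewrite /C mulmxA mul_rV_lin1_linear.
have inj (w1 : 'rV[R]_n) : w1 *m C = 0 -> w1 = 0.
  rewrite CE => E; have h0 : hlift p w1 = 0.
    by apply: (@inner_eq0 _ _ _ g p); rewrite hlift_adjoint E inner0r.
  apply: (@inner_eq0 _ _ _ g' (psi p)); have [v vE] := surj p w1.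
  by rewrite -{2}vE -hlift_adjoint h0 inner0l.
have Cu : C \in unitmx.
  rewrite -row_free_unit -kermx_eq0; apply/eqP/row_matrixP => i; rewrite row0.
  by apply: inj; rewrite -row_mul mulmx_ker row0.
rewrite -CE; apply: (@inner_inj _ _ _ g' (psi p)) => x.
rewrite -(mulmxKV Cu x); set y := x *m _.
rewrite !CE iso; [|exact: horizontal_hlift..].
by rewrite hlift_adjoint.
Qed.

Lemma horizontalB p u v : horizontal psi g p u -> horizontal psi g p v ->
  horizontal psi g p (u - v).
Proof. by move=> hu hv w vw; rewrite innerBl hu// hv// subrr. Qed.

Lemma verticalB p u v : tmap psi p u = tmap psi p v -> vertical psi p (u - v).
Proof. by move=> uv; rewrite /vertical /= (tmapB spsi) uv subrr. Qed.

Lemma horizontal_eq p u : horizontal psi g p u -> u = hlift p (tmap psi p u).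
Proof.
move=> hu; apply/eqP; rewrite -subr_eq0; apply/eqP/(@inner_eq0 _ _ _ g p).
apply: horizontalB => //; first exact: horizontal_hlift.
by apply: verticalB; rewrite tmap_hlift.
Qed.

(** For [w = tmap psi p v], adjunction turns the assumption into [g'(w, w) = 0]. *)
Lemma vertical_of_orthogonal p v :
  (forall w, inner g p (hlift p w) v = 0) -> vertical psi p v.
Proof.
move=> H; apply: (@inner_eq0 _ _ _ g' (psi p)).
by rewrite -hlift_adjoint H.
Qed.

(** Adjunction replaces [g(hlift w, Z)] by [g'(w, tmap psi Z)], in which no lift occurs, and
    [smooth_vfield_inner] concludes. *)
Lemma smooth_hlift_along (w : M -> 'rV[R]_n) :
  (forall p, smooth_along psi p w) -> smooth_vfield (fun p => hlift p (w p)).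
Proof.
move=> sw; apply: (@smooth_vfield_inner _ _ _ g) => Z sZ.
rewrite (_ : innerf _ _ _ = fun p => inner g' (psi p) (w p) (tmap psi p (Z p))); last first.
  by apply/funext => p; rewrite /innerf hlift_adjoint.
apply/smooth_funP => p; apply: (msmooth_inner_along spsi) => //.
exact: smooth_along_tmap.
Qed.

Definition hliftf (X' : vfield N) : vfield M := fun p => hlift p (X' (psi p)).

Lemma smooth_hliftf X' : smooth_vfield X' -> smooth_vfield (hliftf X').
Proof.
move=> sX'; apply: (smooth_hlift_along (w := X' \o psi)) => p.
exact: smooth_along_comp.
Qed.

(** Any extension minus its horizontal part, which vanishes at [p] because [u] is vertical. *)
Lemma exists_vertical_extension p u : vertical psi p u ->
  exists U : vfield M, [/\ smooth_vfield U, forall q, vertical psi q (U q) & U p = u].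
Proof.
move=> vu; have [sZ Zp] := extendP p u.
exists (extend p u - (fun q => hlift q (tmap psi q (extend p u q)))); split.
- apply: (smooth_vfieldB sZ); apply: smooth_hlift_along => q.
  exact: (smooth_along_tmap spsi q sZ).
- by move=> q; apply: verticalB; rewrite tmap_hlift.
- rewrite /GRing.add/= /GRing.opp/= Zp vu /hlift mul0mx; exact: subr0.
Qed.

(** In row convention let [A] be the differential and [S] the lift, so [S A = 1]. Killing vertical
    vectors gives [T A = A T'], horizontal values give [T = T A S]; hence
    [tr T = tr (A T' S) = tr (T' S A) = tr T']. *)
Lemma trace_hlift p (T : 'rV[R]_m -> 'rV[R]_m) (T' : 'rV[R]_n -> 'rV[R]_n) :
  linear T -> linear T' -> (forall z, horizontal psi g p (T z)) ->
  (forall z, vertical psi p z -> T z = 0) ->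
  (forall w, tmap psi p (T (hlift p w)) = T' w) ->
  \tr (lin1_mx T) = \tr (lin1_mx T').
Proof.
move=> lT lT' hT vT TT'; have lt := tmap_linear spsi p.
pose A := lin1_mx (tmap psi p).
pose S := gram g' (psi p) *m A^T *m invmx (gram g p).
have SE (w : 'rV[R]_n) : w *m S = hlift p w by [].
clearbody S.
have SA : S *m A = 1%:M.
  apply/row_matrixP => i; rewrite rowE mulmxA SE /A mul_rV_lin1_linear//.
  by rewrite tmap_hlift row1.
have TA : lin1_mx T *m A = A *m lin1_mx T'.
  apply/row_matrixP => i; rewrite !rowE !mulmxA /A !mul_rV_lin1_linear//.
  set z := delta_mx 0 i; rewrite -TT'.
  have := vT (z - hlift p (tmap psi p z)) (verticalB _).
  rewrite tmap_hlift => /(_ erefl).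
  rewrite addrC -scaleN1r lT scaleN1r addrC => /eqP; rewrite subr_eq0 => /eqP.
  by move=> ->.
have TS : lin1_mx T = lin1_mx T *m A *m S.
  apply/row_matrixP => i; rewrite !rowE !mulmxA SE /A !mul_rV_lin1_linear//.
  exact: horizontal_eq.
by rewrite TS TA -mulmxA mxtrace_mulC -mulmxA SA mulmx1.
Qed.

End HorizontalLift.

(** * Statistical submersions with parallel horizontal distribution *)

Section StatisticalSubmersion.
Variables (R : realType) (m n : nat) (M : manifold R m) (N : manifold R n).
Variables (g : metric M) (nabla : connection M) (g' : metric N).
Variables (nabla' : connection N) (psi : M -> N).
Hypothesis stat : statistical nabla g.
Hypothesis stat' : statistical nabla' g'.
Hypothesis ssub : statistical_submersion psi nabla g nabla' g'.
Hypothesis par : parallel nabla (horizontal psi g).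

Let Rpsi : riemannian_submersion psi g g'. Proof. by case: ssub. Qed.
Let spsi : smooth_map psi. Proof. by case: Rpsi. Qed.
Let tor : torsion_free nabla. Proof. by case: stat. Qed.
Let tor' : torsion_free nabla'. Proof. by case: stat'. Qed.

Definition basic_lift (X : vfield M) (X' : vfield N) : Prop :=
  [/\ smooth_vfield X, smooth_vfield X', forall p, horizontal psi g p (X p) &
      related psi X X'].

Lemma basic_lift_hliftf X' : smooth_vfield X' -> basic_lift (hliftf psi g g' X') X'.
Proof.
move=> sX'; split=> //; first exact: smooth_hliftf.
- by move=> p; exact: horizontal_hlift.
- by move=> p; exact: tmap_hlift.
Qed.

(** Horizontality comes from parallelism, projectability from the statistical submersion. *)
Lemma basic_lift_covd X X' Y Y' : basic_lift X X' -> basic_lift Y Y' ->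
  basic_lift (nabla X Y) (nabla' X' Y').
Proof.
move=> [sX sX' hX rX] [sY sY' hY rY]; split.
- exact: covd_smooth.
- exact: covd_smooth.
- exact: par.
- by have [_ H] := ssub; exact: H.
Qed.

Lemma basic_liftB X X' Y Y' : basic_lift X X' -> basic_lift Y Y' ->
  basic_lift (X - Y) (X' - Y').
Proof.
move=> [sX sX' hX rX] [sY sY' hY rY]; split.
- exact: smooth_vfieldB.
- exact: smooth_vfieldB.
- by move=> p; exact: horizontalB.
- by move=> p; rewrite /GRing.add/= /GRing.opp/= (tmapB spsi) rX rY.
Qed.

Lemma basic_lift_bracket X X' Y Y' : basic_lift X X' -> basic_lift Y Y' ->
  basic_lift (bracket X Y) (bracket X' Y').
Proof.
move=> bX bY; have [sX sX' _ _] := bX; have [sY sY' _ _] := bY.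
rewrite -(tor sX sY) -(tor' sX' sY').
by apply: basic_liftB; exact: basic_lift_covd.
Qed.

Lemma basic_lift_curvature X X' Y Y' Z Z' :
  basic_lift X X' -> basic_lift Y Y' -> basic_lift Z Z' ->
  basic_lift (curvature nabla X Y Z) (curvature nabla' X' Y' Z').
Proof.
move=> bX bY bZ; rewrite /curvature.
apply: basic_liftB; last exact: basic_lift_covd (basic_lift_bracket bX bY) bZ.
by apply: basic_liftB; apply: basic_lift_covd => //; exact: basic_lift_covd.
Qed.

Definition vertical_vfield (U : vfield M) : Prop :=
  smooth_vfield U /\ forall p, vertical psi p (U p).

Lemma covd_lift_vertical_bracket U X X' p : vertical_vfield U -> basic_lift X X' ->
  nabla U X p = nabla X U p + bracket U X p.
Proof.
move=> [sU _] [sX _ _ _].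
have E : nabla U X p - nabla X U p = bracket U X p := congr1 (@^~ p) (tor sU sX).
by rewrite -E addrC subrK.
Qed.

Lemma bracket_vertical U X X' p : vertical_vfield U -> basic_lift X X' ->
  vertical psi p (bracket U X p).
Proof.
move=> [sU vU] [sX sX' _ rX].
exact: (tmap_bracket_vertical spsi p sU sX sX' vU rX).
Qed.

(** Evaluate the Codazzi equation [(nabla_X g)(U, Y) = (nabla_U g)(X, Y)]:
    the left side is [- g(nabla_X U, Y)] and the right side is
    [- g(nabla_X U, Y) - g(X, nabla_Y U)]. *)
Lemma inner_covd_vertical U X X' Y Y' p :
  vertical_vfield U -> basic_lift X X' -> basic_lift Y Y' ->
  inner g p (X p) (nabla Y U p) = 0.
Proof.
move=> vU bX bY; have [sU tU] := vU.
have [sX sX' hX rX] := bX; have [sY sY' hY rY] := bY.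
have [_ cod] := stat; have := congr1 (@^~ p) (cod X U Y sX sU sY).
rewrite /covd_metric.
have -> : innerf g U Y = cst 0.
  by apply/funext => q; rewrite /innerf innerC; exact: hY.
have -> : fderive X (cst 0) p = 0 by exact: tderive_cst.
have -> : fderive U (innerf g X Y) p = 0.
  have -> : innerf g X Y = innerf g' X' Y' \o psi.
    apply/funext => q; rewrite /innerf /= -rX -rY.
    by have [_ _ _ ->] := Rpsi.
  have /smooth_funP/(_ (psi p)) sXY := gram_smooth g' sX' sY'.
  rewrite /fderive (tderive_comp_psi spsi _ sXY) tU.
  exact: derive0.
have -> : innerf g U (nabla X Y) p = 0.
  by rewrite /innerf innerC; apply: par.
rewrite /innerf (covd_lift_vertical_bracket p vU bX) (covd_lift_vertical_bracket p vU bY).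
rewrite innerDl innerDr [inner g p (bracket U X p) _]innerC.
rewrite (hY _ _ (bracket_vertical p vU bX)) (hX _ _ (bracket_vertical p vU bY)).
rewrite !addr0 subr0 sub0r => /eqP.
by rewrite -subr_eq0 opprD opprK addrA addNr add0r opprK => /eqP.
Qed.

(** Every horizontal vector at [p] is the value of a basic field, so [inner_covd_vertical] makes
    [nabla_Y U] orthogonal to the whole horizontal space. *)
Lemma covd_lift_vertical U Y Y' p : vertical_vfield U -> basic_lift Y Y' ->
  vertical psi p (nabla Y U p).
Proof.
move=> vU bY; apply: (vertical_of_orthogonal Rpsi) => w.
have [sw wE] := extendP (psi p) w.
have := inner_covd_vertical p vU (basic_lift_hliftf sw) bY.
by rewrite /hliftf wE.
Qed.

Lemma covd_vertical_lift U Y Y' : vertical_vfield U -> basic_lift Y Y' ->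
  nabla U Y = 0.
Proof.
move=> vU bY; apply/funext => p; have [sU _] := vU; have [sY _ hY _] := bY.
have hUY : horizontal psi g p (nabla U Y p) by exact: par.
have vUY : vertical psi p (nabla U Y p).
  rewrite (covd_lift_vertical_bracket p vU bY) /vertical/=.
  rewrite -[nabla Y U p]scale1r (tmap_linear spsi).
  by rewrite (covd_lift_vertical p vU bY) (bracket_vertical p vU bY) scaler0 addr0.
apply: (@inner_eq0 _ _ _ g p); exact: hUY.
Qed.

Lemma vertical_vfield_bracket U X X' : vertical_vfield U -> basic_lift X X' ->
  vertical_vfield (bracket U X).
Proof.
move=> vU bX; have [sU _] := vU; have [sX _ _ _] := bX.
split; first exact: (smooth_bracket tor sU sX).
by move=> p; exact: (bracket_vertical p vU bX).
Qed.

(** In each of the three terms some basic field is differentiated along a vertical one: [U] for the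
    first two, [[U, X]] for the last. *)
Lemma curvature_vertical U X X' Y Y' : vertical_vfield U -> basic_lift X X' ->
  basic_lift Y Y' -> curvature nabla U X Y = 0.
Proof.
move=> vU bX bY; have [sX _ _ _] := bX.
rewrite /curvature (covd_vertical_lift vU (basic_lift_covd bX bY)).
rewrite (covd_vertical_lift vU bY) (covd0r nabla sX).
by rewrite (covd_vertical_lift (vertical_vfield_bracket vU bX) bY) !subrr.
Qed.

Lemma ricci_lift X X' Y Y' p : basic_lift X X' -> basic_lift Y Y' ->
  ricci nabla X Y p = ricci nabla' X' Y' (psi p).
Proof.
move=> bX bY; have [sX sX' hX rX] := bX; have [sY sY' hY rY] := bY.
apply: (trace_hlift Rpsi).
- exact: (curvature_extend_linear tor p sX sY).
- exact: (curvature_extend_linear tor' (psi p) sX' sY').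
- move=> z; have [sz _] := extendP p z.
  have hXY q : horizontal psi g q (nabla X Y q) by exact: (par sX sY hY).
  have hzY q : horizontal psi g q (nabla (extend p z) Y q) by exact: (par sz sY hY).
  have sXY := covd_smooth nabla sX sY; have szY := covd_smooth nabla sz sY.
  apply: horizontalB; last exact: (par (smooth_bracket tor sz sX) sY hY).
  by apply: horizontalB; [exact: (par sz sXY hXY)|exact: (par sX szY hzY)].
(* By tensoriality the arbitrary extension of [z] may be traded for a vertical field, and below, for
   a lifted vector, for a basic one. *)
- move=> z vz; have [U [sU vU UE]] := exists_vertical_extension Rpsi vz.
  have [sz zE] := extendP p z.
  rewrite (curvature_tensorial tor sz sU sX sY (etrans zE (esym UE))).
  by rewrite (curvature_vertical (conj sU vU) bX bY).
- move=> w; have [sw wE] := extendP (psi p) w.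
  have bW := basic_lift_hliftf sw; have [sW _ _ _] := bW.
  have [sz zE] := extendP p (hlift psi g g' p w).
  have E : extend p (hlift psi g g' p w) p = hliftf psi g g' (extend (psi p) w) p.
    by rewrite zE /hliftf wE.
  rewrite (curvature_tensorial tor sz sW sX sY E).
  by have [_ _ _ ->] := basic_lift_curvature bW bX bY.
Qed.

(** The argument of [ricci_lift], for the endomorphism [z |-> nabla_z V]. *)
Lemma trace_covd_lift V V' p : basic_lift V V' ->
  \tr (lin1_mx (fun z => nabla (extend p z) V p)) =
  \tr (lin1_mx (fun w => nabla' (extend (psi p) w) V' (psi p))).
Proof.
move=> bV; have [sV sV' hV rV] := bV.
apply: (trace_hlift Rpsi).
- exact: covd_extend_linear.
- exact: covd_extend_linear.
- by move=> z; have [sz _] := extendP p z; exact: (par sz sV hV).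
- move=> z vz; have [U [sU vU UE]] := exists_vertical_extension Rpsi vz.
  have [sz zE] := extendP p z.
  rewrite (covd_tensorial nabla sz sU sV (etrans zE (esym UE))).
  by rewrite (covd_vertical_lift (conj sU vU) bV).
- move=> w; have [sw wE] := extendP (psi p) w.
  have bW := basic_lift_hliftf sw; have [sW _ _ _] := bW.
  have [sz zE] := extendP p (hlift psi g g' p w).
  have E : extend p (hlift psi g g' p w) p = hliftf psi g g' (extend (psi p) w) p.
    by rewrite zE /hliftf wE.
  rewrite (covd_tensorial nabla sz sW sV E).
  by have [_ _ _ ->] := basic_lift_covd bW bV.
Qed.

End StatisticalSubmersion.

(** * The trace of the soliton equation *)

Section ScalarCurvature.
Variables (R : realType) (n : nat) (M : manifold R n).

Lemma inner_delta (g : metric M) p i j :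
  inner g p (delta_mx 0 i) (delta_mx 0 j) = gram g p i j.
Proof. by rewrite /inner /form_at -rowE trmx_delta -colE !mxE. Qed.

(** Half of [L_V g] is the symmetric part of the form [g(nabla_X V, Y)], whose metric trace is that
    of [nabla V]; the metric itself has trace [n]. *)
Lemma scalar_curvature_soliton (g : metric M) (nabla : connection M)
    (V : vfield M) (kappa : R) p : smooth_vfield V ->
  (forall X Y, smooth_vfield X -> smooth_vfield Y ->
     2^-1 * lie_metric nabla g V X Y p + ricci nabla X Y p +
     kappa * innerf g X Y p = 0) ->
  scalar_curvature nabla g p =
  - \tr (lin1_mx (fun z => nabla (extend p z) V p)) - kappa * n%:R.
Proof.
move=> sV H; set B := lin1_mx _; rewrite /scalar_curvature.
have BE i j : (B *m gram g p) i j =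
    inner g p (nabla (extend p (delta_mx 0 i)) V p) (delta_mx 0 j).
  rewrite /inner /form_at.
  rewrite -(mul_rV_lin1_linear (delta_mx 0 i) (covd_extend_linear nabla p sV)) -/B.
  by rewrite -(mulmxA (delta_mx 0 i)) -rowE trmx_delta -colE [RHS]mxE [RHS]mxE.
(* The soliton equation at [p], solved for the Ricci matrix. *)
have -> : \matrix_(i, j) ricci nabla (extend p (delta_mx 0 i)) (extend p (delta_mx 0 j)) p =
    - (2^-1 *: (B *m gram g p + (B *m gram g p)^T)) - kappa *: gram g p.
  apply/matrixP => i j.
  have [si ei] := extendP p (delta_mx 0 i : 'rV[R]_n).
  have [sj ej] := extendP p (delta_mx 0 j : 'rV[R]_n).
  have := H _ _ si sj; rewrite /lie_metric /innerf ei ej inner_delta -!BE => E.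
  rewrite [LHS]mxE [RHS]mxE [X in _ = X + _]mxE [X in _ = - X + _]mxE.
  rewrite [X in _ = - (_ * X) + _]mxE [(_^T) i j]mxE [X in _ = _ + X]mxE [X in _ = _ - X]mxE.
  by lra.
have Gu := gram_unitmx g p.
rewrite mulmxDr mulmxN mxtraceD -!scalemxAr mulmxN -scalemxAr !raddfN /= !mxtraceZ.
rewrite mulVmx// mxtrace1 mulmxDr mxtraceD trmx_mul gram_sym (mulKmx Gu) mxtrace_tr.
rewrite mxtrace_mulC mulmxK//.
by congr (_ - _); rewrite -mulr2n -[X in _ * X]mulr_natl mulrA mulVf ?mul1r ?pnatr_eq0.
Qed.

End ScalarCurvature.

(** * Descent of the soliton equation to the base *)

Section Soliton.
Variables (R : realType) (m n : nat) (M : manifold R m) (N : manifold R n).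
Variables (g : metric M) (nabla : connection M) (g' : metric N).
Variables (nabla' : connection N) (psi : M -> N).
Variables (V : vfield M) (lambda rho : R).
Hypothesis stat : statistical nabla g.
Hypothesis stat' : statistical nabla' g'.
Hypothesis ssub : statistical_submersion psi nabla g nabla' g'.
Hypothesis par : parallel nabla (horizontal psi g).
Hypothesis sol : ricci_bourguignon_soliton nabla g V lambda rho.

Let Rpsi : riemannian_submersion psi g g'. Proof. by case: ssub. Qed.

Lemma soliton_lift X X' Y Y' p :
  basic_lift g psi X X' -> basic_lift g psi Y Y' ->
  2^-1 * lie_metric nabla g V X Y p + ricci nabla' X' Y' (psi p) +
  (lambda - rho * scalar_curvature nabla g p) * innerf g' X' Y' (psi p) = 0.
Proof.
move=> bX bY; have [sX sX' hX rX] := bX; have [sY sY' hY rY] := bY.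
have [_ _ eqM] := sol; have := eqM X Y sX sY p.
rewrite (ricci_lift stat stat' ssub par p bX bY).
have [_ _ _ iso] := Rpsi.
by rewrite {1}/innerf -(iso _ _ _ (hX p) (hY p)) rX rY.
Qed.

Lemma einstein_of_vertical : (forall p, vertical psi p (V p)) -> einstein nabla' g'.
Proof.
move=> vV; have [sV _ _] := sol; have [_ surj _ _] := Rpsi.
(* A set-theoretic section of [psi] turns the factor, a function on [M], into a function on [N]. *)
have /choice[s sE] := surj.
exists (fun q => - (lambda - rho * scalar_curvature nabla g (s q))) => X' Y' sX' sY' q.
have bX := basic_lift_hliftf ssub sX'; have bY := basic_lift_hliftf ssub sY'.
have [_ _ hX _] := bX; have [_ _ hY _] := bY.
have vV' : vertical_vfield psi V by split.
have := soliton_lift (s q) bX bY; rewrite /lie_metric /innerf.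
rewrite [inner g _ _ (hliftf _ _ _ Y' _)]innerC.
rewrite (hY _ _ (covd_lift_vertical stat ssub par _ vV' bX)).
rewrite [inner g _ _ (hliftf _ _ _ X' _)]innerC.
rewrite (hX _ _ (covd_lift_vertical stat ssub par _ vV' bY)).
rewrite sE addr0 mulr0 add0r => /eqP; rewrite addr_eq0 => /eqP ->.
by rewrite mulNr.
Qed.

(** The identity of the tangent space of [N] factors through that of [M] by the lift. This makes the
    truncated [m - n] the true fibre dimension. *)
Lemma dim_base_le (p : M) : (n <= m)%N.
Proof.
have [spsi _ _ _] := Rpsi.
pose S := gram g' (psi p) *m (lin1_mx (tmap psi p))^T *m invmx (gram g p).
have SA : S *m lin1_mx (tmap psi p) *m 1%:M = 1%:M.
  rewrite mulmx1; apply/row_matrixP => i; rewrite !rowE mulmxA mulmx1.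
  by rewrite (mul_rV_lin1_linear _ (tmap_linear spsi p)) (tmap_hlift Rpsi).
exact: leq_trans (mulmx1_min_rank SA) (rank_leq_row _).
Qed.

(** [nabla_X V] is basic, so the Lie term descends too. With [tau] the common trace of [nabla V] and
    [nabla' V'], the traced equations read [R = - tau - kappa m] and [R' = - tau - kappa n]. *)
Lemma soliton_of_lift V' p : basic_lift g psi V V' ->
  let kappa := lambda - rho * scalar_curvature nabla g p in
  (forall X' Y', smooth_vfield X' -> smooth_vfield Y' ->
    2^-1 * lie_metric nabla' g' V' X' Y' (psi p) + ricci nabla' X' Y' (psi p) +
    kappa * innerf g' X' Y' (psi p) = 0) /\
  scalar_curvature nabla' g' (psi p) =
    scalar_curvature nabla g p + kappa * (m - n)%:R.
Proof.
move=> bV kappa; have [sV sV' hV rV] := bV; have [_ _ eqM] := sol.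
have eqN X' Y' : smooth_vfield X' -> smooth_vfield Y' ->
    2^-1 * lie_metric nabla' g' V' X' Y' (psi p) + ricci nabla' X' Y' (psi p) +
    kappa * innerf g' X' Y' (psi p) = 0.
  move=> sX' sY'.
  have bX := basic_lift_hliftf ssub sX'; have bY := basic_lift_hliftf ssub sY'.
  have [_ _ hXV rXV] := basic_lift_covd ssub par bX bV.
  have [_ _ hYV rYV] := basic_lift_covd ssub par bY bV.
  have [_ _ hX rX] := bX; have [_ _ hY rY] := bY.
  have [_ _ _ iso] := Rpsi.
  have := soliton_lift p bX bY; rewrite /lie_metric {1 2}/innerf.
  rewrite -(iso _ _ _ (hXV p) (hY p)) -(iso _ _ _ (hYV p) (hX p)).
  by rewrite rXV rY rYV rX.
split=> //.
rewrite (scalar_curvature_soliton sV' eqN).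
rewrite (scalar_curvature_soliton sV (fun X Y sX sY => eqM X Y sX sY p)) -/kappa.
rewrite (trace_covd_lift stat ssub par p bV) natrB ?dim_base_le//.
by rewrite mulrBr addrA subrK.
Qed.

(** Put [d = m - n]. Substituting [R = R' - kappa d] in [kappa = lambda - rho R] gives
    [kappa (1 - rho d) = lambda - rho R'], which determines [kappa] from [R'] unless [rho d = 1]. *)
Lemma soliton_of_horizontal V' : (forall p, horizontal psi g p (V p)) ->
  (rho * (m - n)%:R = 1 -> exists r, forall p, scalar_curvature nabla g p = r) ->
  smooth_vfield V' -> related psi V V' ->
  exists lambda' rho' : R, ricci_bourguignon_soliton nabla' g' V' lambda' rho'.
Proof.
move=> hV const sV' rV; have [sV rho0 _] := sol; have [_ surj _ _] := Rpsi.
have bV : basic_lift g psi V V' by split.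
have [d1|d1] := eqVneq (rho * (m - n)%:R) 1.
  have [r Rr] := const d1.
  (* Here [kappa = lambda - rho r] is constant and [R' = lambda d]; with [rho' = 1], the value
     [lambda' = kappa + R'] gives back [lambda' - R' = kappa]. *)
  exists (lambda - rho * r + lambda * (m - n)%:R), 1.
  split=> // X' Y' sX' sY' q; have [p <-] := surj q.
  have [eqN ->] := soliton_of_lift p bV; rewrite -[RHS](eqN X' Y' sX' sY') Rr.
  congr (_ + _ * _); apply/eqP; rewrite -subr_eq0; apply/eqP.
  transitivity (r * (rho * (m - n)%:R - 1)); first ring.
  by rewrite d1 subrr mulr0.
have d0 : 1 - rho * (m - n)%:R != 0 by rewrite subr_eq0 eq_sym.
exists (lambda / (1 - rho * (m - n)%:R)), (rho / (1 - rho * (m - n)%:R)).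
split=> //; first by rewrite mulf_neq0// invr_neq0.
move=> X' Y' sX' sY' q; have [p <-] := surj q.
have [eqN ->] := soliton_of_lift p bV; rewrite -[RHS](eqN X' Y' sX' sY').
by congr (_ + _ * _); field.
Qed.

End Soliton.

(* Part (2) fails without its second premise: if rho times the fibre dimension
   is 1, the soliton equation of M no longer determines its scalar curvature. *)
Theorem theorem5p7 (R : realType) (m n : nat)
    (M : manifold R m) (N : manifold R n)
    (g : metric M) (nabla : connection M)
    (g' : metric N) (nabla' : connection N)
    (V : vfield M) (lambda rho : R) (psi : M -> N) :
  (3 <= m)%N ->
  statistical nabla g ->
  statistical nabla' g' ->
  ricci_bourguignon_soliton nabla g V lambda rho ->
  statistical_submersion psi nabla g nabla' g' ->
  parallel nabla (horizontal psi g) ->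
  ((forall p, vertical psi p (V p)) -> einstein nabla' g') /\
  ((forall p, horizontal psi g p (V p)) ->
   (rho * (m - n)%:R = 1 ->
      exists r, forall p, scalar_curvature nabla g p = r) ->
   forall V' : vfield N, smooth_vfield V' -> related psi V V' ->
   exists lambda' rho' : R,
     ricci_bourguignon_soliton nabla' g' V' lambda' rho').
Proof.
move=> _ stat stat' sol ssub par; split.
  exact: (einstein_of_vertical stat stat' ssub par sol).
move=> hV const V' sV' rV.
exact: (soliton_of_horizontal stat stat' ssub par sol hV const sV' rV).
Qed.
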